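(* Let $P,Q$ be distributions over $x=(x_1,x_2)$ with $x_1\in\mathbb{R}^{d_1}$, $x_2\in\mathbb{R}^{d_2}$. Assume $x$ is Gaussian with zero mean under both $P$ and $Q$, that $P$ and $Q$ have matching marginals on $x_1$ and on $x_2$ (the law of $x_1$ is the same under $P$ and $Q$, and likewise for $x_2$), and that $\mathbb{E}_P[x_1x_1^\top]=I_{d_1}$, $\mathbb{E}_P[x_2x_2^\top]=I_{d_2}$. Let $\Sigma_P=\mathbb{E}_P[xx^\top]$ and $\mathcal{F}=\{f_1(x_1)+f_2(x_2): f_i:\mathbb{R}^{d_i}\to\mathbb{R},\ \mathbb{E}_P[f_i(x_i)^2]<\infty,\ i=1,2\}$. Then $$\tau(P,Q,\mathcal{F})\le\frac{2}{\lambda_{\min}(\Sigma_P)}.$$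
   Context: $\tau(P,Q,\mathcal{F})=\sup_{f,g\in\mathcal{F}}\mathbb{E}_Q[(f(x)-g(x))^2]/\mathbb{E}_P[(f(x)-g(x))^2]$ with the convention $0/0=0$. $\lambda_{\min}$ is the smallest eigenvalue; the bound is $+\infty$ if it is $0$. *)

(* Defs.v *)
From HB Require Import structures.
From mathcomp Require Import all_boot all_order all_algebra.
From mathcomp Require Import all_classical all_reals all_analysis.
Set Implicit Arguments. Unset Strict Implicit. Unset Printing Implicit Defensive.
Import Order.TTheory GRing.Theory Num.Theory.
Local Open Scope classical_set_scope.
Local Open Scope ring_scope.

Definition eratio (R : realType) (num den : \bar R) : \bar R :=
  if den == 0%E then (if num == 0%E then 0%E else +oo%E)
  else (num * ((fine den)^-1)%:E)%E.

Definition tau d (T : measurableType d) (R : realType)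
  (P Q : probability T R) (F : set (T -> R)) : \bar R :=
  ereal_sup [set r | exists f g, F f /\ F g /\
     r = eratio (\int[Q]_x ((f x - g x) ^+ 2)%:E)%E
                (\int[P]_x ((f x - g x) ^+ 2)%:E)%E].

Definition xspace (R : realType) (d1 d2 : nat) := (d1.-tuple R * d2.-tuple R)%type.

Definition xcoord (R : realType) (d1 d2 : nat) (k : 'I_(d1 + d2))
  (x : xspace R d1 d2) : R :=
  match fintype.split k with
  | inl i => tnth x.1 i
  | inr j => tnth x.2 j
  end.

(* a zero-mean (possibly degenerate) Gaussian law: every linear functional
   of x is N(0, s^2) for some s <> 0, or the Dirac mass at 0 *)
Definition centered_gaussian (R : realType) (d1 d2 : nat)
  (P : probability (xspace R d1 d2) R) : Prop :=
  forall a : 'I_(d1 + d2) -> R,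
    let L := pushforward P (fun x => \sum_(k < d1 + d2) a k * xcoord k x) in
    (forall A : set R, measurable A -> L A = \d_(0 : R) A) \/
    (exists s : R, s != 0 /\
       forall A : set R, measurable A -> L A = normal_prob 0 s A).

Definition second_moment (R : realType) (d1 d2 : nat)
  (P : probability (xspace R d1 d2) R) : 'M[R]_(d1 + d2) :=
  \matrix_(k, l) fine (\int[P]_x (xcoord k x * xcoord l x)%:E)%E.

Definition lambda_min (R : realType) (n : nat) (M : 'M[R]_n) : R :=
  inf [set l : R | eigenvalue M l].

Definition additive_class (R : realType) (d1 d2 : nat)
  (P : probability (xspace R d1 d2) R) : set (xspace R d1 d2 -> R) :=
  [set f | exists (f1 : d1.-tuple R -> R) (f2 : d2.-tuple R -> R),
     [/\ measurable_fun setT f1, measurable_fun setT f2,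
         (\int[P]_x ((f1 x.1) ^+ 2)%:E < +oo)%E,
         (\int[P]_x ((f2 x.2) ^+ 2)%:E < +oo)%E &
         f = (fun x => f1 x.1 + f2 x.2)]].

Definition bound (R : realType) (l : R) : \bar R :=
  if l == 0 then +oo%E else (2 / l)%:E.

(* Main.v *)
Require Import Defs.
From HB Require Import structures.
From mathcomp Require Import all_boot all_order all_algebra.
From mathcomp Require Import all_classical all_reals all_analysis.
From mathcomp Require Import measurable_realfun lebesgue_Rintegral normal_distribution ring lra.
Set Implicit Arguments. Unset Strict Implicit. Unset Printing Implicit Defensive.
Import Order.TTheory GRing.Theory Num.Theory.
Import numFieldNormedType.Exports.
Local Open Scope classical_set_scope.
Local Open Scope ring_scope.

(* It suffices to bound E_Q h^2 by (2 / l) E_P h^2 for h = h_1(x_1) + h_2(x_2),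
   where l is the smallest eigenvalue of Sigma_P.

   When h is a combination of exponentials c_p exp (u_p . x), each u_p living in
   one of the two blocks, the Gaussian Laplace transform turns E_P h^2 into a
   quadratic form with kernel exp (u_p^T Sigma_P u_q), in coefficients that
   depend only on the marginals and hence are the same for P and Q.  The
   inequality becomes the positivity of the kernel
   (2 / l) exp (u_p^T Sigma_P u_q) - exp (u_p^T Sigma_Q u_q), which holds term by
   term in the Taylor series of exp, by the Schur product theorem and
   Sigma_P >= l I.  This replaces the Hermite expansion behind the Gaussian
   maximal correlation inequality.

   The general case follows because exponentials span a dense subspace of L^2 of
   a law with finite exponential moments: their closure under dominated
   pointwise limits contains the polynomials, then sin (b . x + c), then the
   indicators of half-spaces, and therefore all indicators of Borel sets. *)

(** * Rayleigh quotients *)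

(** Each [|v i * v j|] is at most the squared norm, so the sum of the [|M i j|] works as a constant.
    The added 1 keeps [K] positive when [M] is zero, since a product of such constants is inverted
    later. *)
Lemma quad_le_sqnorm (R : realType) (n : nat) (M : 'M[R]_n) :
  exists2 K : R, 0 < K &
  forall v : 'rV[R]_n, (v *m M *m v^T) 0 0 <= K * (v *m v^T) 0 0.
Proof.
exists (1 + \sum_i \sum_j `|M i j|).
  by rewrite ltr_pwDl// sumr_ge0// => i _; rewrite sumr_ge0.
move=> v.
have sqE : (v *m v^T) 0 0 = \sum_i v 0 i ^+ 2.
  by rewrite mxE; apply: eq_bigr => i _; rewrite mxE expr2.
have sq_ge0 : 0 <= (v *m v^T) 0 0.
  by rewrite sqE sumr_ge0// => i _; rewrite sqr_ge0.
have vle i : v 0 i ^+ 2 <= (v *m v^T) 0 0.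
  by rewrite sqE (bigD1 i)//= lerDl sumr_ge0// => k _; rewrite sqr_ge0.
have -> : (v *m M *m v^T) 0 0 = \sum_i \sum_j M i j * (v 0 i * v 0 j).
  rewrite mxE exchange_big/=; apply: eq_bigr => j _.
  rewrite !mxE mulr_suml; apply: eq_bigr => i _.
  by ring.
rewrite mulrDl mul1r ler_wpDl// mulr_suml ler_sum// => i _.
rewrite mulr_suml ler_sum// => j _.
rewrite (le_trans (ler_norm _))// normrM ler_wpM2l//.
have := vle i; have := vle j.
have := sqr_ge0 (v 0 i - v 0 j); have := sqr_ge0 (v 0 i + v 0 j).
by rewrite ler_norml; move=> *; apply/andP; split; nra.
Qed.

(** In dimension 0 every eigenspace is trivial, and the infimum of the empty set is 0 by default. *)
Lemma lambda_min_mx0 (R : realType) (S : 'M[R]_0) : lambda_min S = 0.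
Proof.
rewrite /lambda_min (_ : [set _ | _] = set0) ?inf0//.
apply/seteqP; split => // l /=.
by rewrite /eigenvalue (flatmx0 (eigenspace S l)) eqxx.
Qed.

(* If the infimum [m] of the Rayleigh quotient were not an eigenvalue, then
   [S - m] would be invertible and Cauchy-Schwarz would bound its form below by
   a positive multiple of the squared norm. *)
Lemma lambda_min_rayleigh (R : realType) (n : nat) (S : 'M[R]_n) :
  S^T = S -> (forall v : 'rV[R]_n, 0 <= (v *m S *m v^T) 0 0) ->
  0 <= lambda_min S /\
  forall v : 'rV[R]_n,
    lambda_min S * (v *m v^T) 0 0 <= (v *m S *m v^T) 0 0.
Proof.
move=> Ssym Spsd.
case: n S Ssym Spsd => [|n] S Ssym Spsd.
  rewrite lambda_min_mx0.
  by split => // v; rewrite mul0r Spsd.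
pose nrm (v : 'rV[R]_n.+1) := (v *m v^T) 0 0.
have nrmE v : nrm v = \sum_i v 0 i ^+ 2.
  by rewrite /nrm mxE; apply: eq_bigr => i _; rewrite mxE expr2.
have nrm_ge0 v : 0 <= nrm v.
  by rewrite nrmE sumr_ge0// => i _; rewrite sqr_ge0.
have nrm_gt0 v : v != 0 -> 0 < nrm v.
  move=> v0; rewrite lt_neqAle nrm_ge0 andbT eq_sym; apply: contra v0.
  rewrite nrmE psumr_eq0 => [/allP h|i _]; last by rewrite sqr_ge0.
  apply/eqP/rowP => i; rewrite mxE; apply/eqP.
  by rewrite -sqrf_eq0 (implyP (h i _))// mem_index_enum.
(* The supremum of [T] is the infimum of the Rayleigh quotients; the multiplicative form makes sense
   at [v = 0] too. *)
pose T := [set t : R | forall v : 'rV_n.+1, t * nrm v <= (v *m S *m v^T) 0 0].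
have T0 : T 0 by move=> v; rewrite mul0r Spsd.
pose e0 : 'rV[R]_n.+1 := delta_mx 0 0.
have e0N : e0 != 0.
  apply/eqP => /rowP /(_ 0); rewrite !mxE/= => /eqP; by rewrite oner_eq0.
have Tub : ubound T ((e0 *m S *m e0^T) 0 0 / nrm e0).
  by move=> t /(_ e0); rewrite ler_pdivlMr// nrm_gt0.
have Tsup : has_sup T by split; [exists 0 | eexists; exact: Tub].
pose m := sup T.
have m0 : 0 <= m by apply: ub_le_sup => //; exact: Tsup.2.
have Tm : T m.
  move=> v; have [->|v0] := eqVneq v 0.
    by rewrite /nrm !mul0mx mxE mulr0.
  rewrite -ler_pdivlMr ?nrm_gt0//; apply: ge_sup; first by exists 0.
  by move=> t Tt; rewrite ler_pdivlMr ?nrm_gt0//; exact: Tt.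
pose B := S - m%:M.
have BE (v : 'rV[R]_n.+1) : (v *m B *m v^T) 0 0 = (v *m S *m v^T) 0 0 - m * nrm v.
  rewrite /B mulmxBr mul_mx_scalar mulmxBl -scalemxAl [LHS]mxE.
  by rewrite [X in _ + X]mxE [X in _ - X]mxE.
have Bsym : B^T = B by rewrite /B linearB/= tr_scalar_mx Ssym.
have Bpsd (v : 'rV[R]_n.+1) : 0 <= (v *m B *m v^T) 0 0 by rewrite BE subr_ge0; exact: Tm.
have Bcs (x y : 'rV[R]_n.+1) : ((x *m B *m y^T) 0 0) ^+ 2 <=
    (x *m B *m x^T) 0 0 * (y *m B *m y^T) 0 0.
  set a := (x *m B *m x^T) 0 0; set b := (x *m B *m y^T) 0 0.
  set c := (y *m B *m y^T) 0 0.
  have bE : (y *m B *m x^T) 0 0 = b.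
    rewrite /b -[in RHS](trmxK (x *m B *m y^T)) [RHS]mxE.
    by rewrite !trmx_mul trmxK Bsym mulmxA.
  have h (s t : R) : 0 <= s ^+ 2 * a + 2 * s * t * b + t ^+ 2 * c.
    suff <- : ((s *: x + t *: y) *m B *m (s *: x + t *: y)^T) 0 0
        = s ^+ 2 * a + 2 * s * t * b + t ^+ 2 * c by exact: Bpsd.
    rewrite [(_ + _)^T]linearD/= [(s *: x)^T]linearZ/= [(t *: y)^T]linearZ/=.
    rewrite mulmxDl mulmxDr !mulmxDl.
    rewrite -!scalemxAl -!scalemxAr.
    have mE (k l : R) (M : 'M[R]_1) : (k *: (l *: M)) 0 0 = k * (l * M 0 0).
      by rewrite !mxE.
    have aE (M N : 'M[R]_1) : (M + N) 0 0 = M 0 0 + N 0 0 by rewrite mxE.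
    by rewrite !aE !mE bE -/a -/b -/c; ring.
  have a0 : 0 <= a := Bpsd x; have c0 : 0 <= c := Bpsd y.
  (* The form may be degenerate. If [c > 0], the pair [(c, - b)] gives [c * (a * c - b ^+ 2) >= 0];
     if [a > 0], [(- b, a)] gives the same with factor [a]; if both vanish, [(1, - b)] gives
     [- 2 * b ^+ 2 >= 0]. *)
  have [cE|cN] := eqVneq c 0; last first.
    have cp : 0 < c by rewrite lt_neqAle eq_sym cN.
    rewrite -subr_ge0 -(pmulr_rge0 _ cp).
    by rewrite (le_trans (h c (- b)))// le_eqVlt; apply/orP/or_introl/eqP; ring.
  have [aE|aN] := eqVneq a 0; last first.
    have ap : 0 < a by rewrite lt_neqAle eq_sym aN.
    rewrite -subr_ge0 -(pmulr_rge0 _ ap).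
    by rewrite (le_trans (h (- b) a))// le_eqVlt; apply/orP/or_introl/eqP; ring.
  have := h 1 (- b); rewrite aE cE => hb; rewrite mul0r; lra.
have eigm : eigenvalue S m.
  apply: contrapT => /negP; rewrite /eigenvalue negbK => /eqP E0.
  have Bu : B \in unitmx.
    rewrite -row_free_unit -kermx_eq0; apply/eqP; exact: E0.
  have [K K0 HK] := quad_le_sqnorm B.
  have [L L0 HL] := quad_le_sqnorm (invmx B *m (invmx B)^T).
  (* With [w = v B], invertibility gives [nrm v <= L * nrm w]. Cauchy-Schwarz for [v] and [w] bounds
     [nrm w ^+ 2] by the form at [v] times the form at [w], the latter being at most [K * nrm w];
     then one factor [nrm w] cancels. *)
  have key (v : 'rV[R]_n.+1) : nrm v <= K * L * (v *m B *m v^T) 0 0.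
    pose w := v *m B.
    have vE : v = w *m invmx B by rewrite /w mulmxK.
    have n1 : nrm v <= L * nrm w.
      have := HL w; rewrite mulmxA -mulmxA -trmx_mul.
      by rewrite -vE.
    have := Bcs v w; rewrite -/w -/(nrm w) => cs.
    have := HK w; rewrite -/(nrm w) => n2.
    have q0 := Bpsd v; rewrite -/w in q0 *.
    have [w0|wN] := eqVneq (nrm w) 0.
      by rewrite (le_trans n1)// w0 mulr0 mulr_ge0// mulr_ge0// ltW.
    have wp : 0 < nrm w by rewrite lt_neqAle eq_sym wN nrm_ge0.
    have : nrm w <= K * (w *m v^T) 0 0.
      rewrite -(ler_pM2r wp) -expr2 (le_trans cs)//.
      by rewrite [leRHS]mulrAC [leRHS]mulrC ler_wpM2l.
    move=> n3; rewrite (le_trans n1)// (mulrC K) -mulrA ler_wpM2l// ltW//.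
  have : T (m + (K * L)^-1).
    move=> v; have := key v; rewrite BE -/(nrm v) => kv.
    rewrite mulrDl addrC -lerBrDr mulrC ler_pdivrMr ?mulr_gt0//.
    by rewrite mulrC.
  move=> /(ub_le_sup Tsup.2); rewrite -/m gerDl.
  by rewrite leNgt invr_gt0 mulr_gt0.
have eiglb : lbound [set l : R | eigenvalue S l] m.
  move=> l /= /eigenvalueP[v vS v0].
  have := Tm v; rewrite vS -scalemxAl [X in _ <= X]mxE -/(nrm v).
  by rewrite ler_pM2r// nrm_gt0.
have -> : lambda_min S = m.
  apply/eqP; rewrite eq_le; apply/andP; split.
    by apply: ge_inf => //; exists m.
  by apply: lb_le_inf => //; exists m.
by split => // v; exact: Tm.
Qed.

(** * Real-valued integrals and Gaussian Laplace transforms *)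

Definition rintegrable d (T : measurableType d) (R : realType)
  (mu : {measure set T -> \bar R}) (f : T -> R) :=
  mu.-integrable setT (EFin \o f).

Section rintegrable_theory.
Context d (T : measurableType d) (R : realType) (mu : {measure set T -> \bar R}).
Implicit Types f g : T -> R.

Lemma rintegrable_le f g : measurable_fun setT f ->
  (forall x, `|f x| <= g x) -> rintegrable mu g -> rintegrable mu f.
Proof.
move=> mf fg ig; apply: (le_integrable _ _ _ ig) => //.
  exact/measurable_EFinP.
by move=> x _ /=; rewrite lee_fin (le_trans (fg x))// ler_norm.
Qed.

Lemma rintegrableD f g : rintegrable mu f -> rintegrable mu g ->
  rintegrable mu (fun x => f x + g x).
Proof. by move=> hf hg; exact: (integrableD _ hf hg). Qed.

Lemma rintegrableZ (k : R) f : rintegrable mu f ->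
  rintegrable mu (fun x => k * f x).
Proof. by move=> hf; exact: (integrableZl _ k hf). Qed.

Lemma rintegrable_sum I (s : seq I) (h : I -> T -> R) :
  (forall i, rintegrable mu (h i)) ->
  rintegrable mu (fun x => \sum_(i <- s) h i x).
Proof.
move=> hi; rewrite /rintegrable.
rewrite (_ : _ \o _ = fun x => (\sum_(i <- s) (h i x)%:E)%E).
  by apply: integrable_sum => // i _; exact: hi.
by apply/funext => x /=; rewrite sumEFin.
Qed.

Lemma Rintegral_sum I (s : seq I) (h : I -> T -> R) :
  (forall i, rintegrable mu (h i)) ->
  \int[mu]_x (\sum_(i <- s) h i x) = \sum_(i <- s) \int[mu]_x h i x.
Proof.
move=> hi; elim: s => [|i s IH].
  under eq_Rintegral do rewrite big_nil.
  by rewrite big_nil /Rintegral integral0.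
under eq_Rintegral do rewrite big_cons.
rewrite big_cons RintegralD// ?IH//; first exact: hi.
exact: (rintegrable_sum s hi).
Qed.

Lemma RintegrableD f g : rintegrable mu f -> rintegrable mu g ->
  \int[mu]_x (f x + g x) = \int[mu]_x f x + \int[mu]_x g x.
Proof. by move=> hf hg; rewrite RintegralD. Qed.

Lemma RintegrableZ (k : R) f : rintegrable mu f ->
  \int[mu]_x (k * f x) = k * \int[mu]_x f x.
Proof. by move=> hf; rewrite RintegralZl. Qed.

Lemma EFin_Rintegral f : rintegrable mu f ->
  (\int[mu]_x (f x)%:E)%E = (\int[mu]_x f x)%:E.
Proof. by move=> hf; rewrite /Rintegral fineK//; exact: integrable_fin_num. Qed.

Lemma rintegrable_ge0 f : measurable_fun setT f -> (forall x, 0 <= f x) ->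
  (\int[mu]_x (f x)%:E < +oo)%E -> rintegrable mu f.
Proof.
move=> mf f0 h; apply/integrableP; split; first exact/measurable_EFinP.
by under eq_integral do rewrite /= ger0_norm//.
Qed.

Lemma dominated_Rintegral (u : nat -> T -> R) f g :
  (forall n, measurable_fun setT (u n)) ->
  (forall x, u n x @[n --> \oo] --> f x) ->
  (forall n x, `|u n x| <= g x) -> rintegrable mu g ->
  rintegrable mu f /\ \int[mu]_x u n x @[n --> \oo] --> \int[mu]_x f x.
Proof.
move=> mu_ uf ug ig.
have mf : measurable_fun setT f.
  by apply: (@measurable_fun_cvg _ _ _ setT u) => // x _; exact: uf.
have gf : rintegrable mu f.
  apply: (rintegrable_le mf _ ig) => x.
  by apply: (cvgr_to_le (cvg_norm (uf x))); near=> n; exact: ug.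
split => //.
have [|||||_ _ h] := @dominated_convergence _ T R mu setT measurableT
    (fun n => EFin \o u n) (EFin \o f) (EFin \o g).
- by move=> n; exact/measurable_EFinP.
- exact/measurable_EFinP.
- by apply: aeW => x _; apply: cvg_EFin; [near=> n|exact: uf].
- exact: ig.
- by apply: aeW => x n _ /=; rewrite lee_fin.
suff /fine_cvgP[] : (\int[mu]_x (u n x)%:E)%E @[n --> \oo] -->
    (\int[mu]_x f x)%:E by [].
by rewrite -EFin_Rintegral.
Unshelve. all: by end_near.
Qed.

(** The squared L^2 norm, kept in the extended reals so that comparisons can be stated before
    integrability is known. *)
Definition sqint f := (\int[mu]_x (f x ^+ 2)%:E)%E.

Lemma sqint_ge0 f : (0 <= sqint f)%E.
Proof. by apply: integral_ge0 => x _; rewrite lee_fin sqr_ge0. Qed.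

(** Stands in for the triangle inequality in L^2: [a = b = 2] gives the crude version, Young weights
    give one with leading constant close to 1. *)
Lemma sqint_le f g (h : T -> R) (a b : R) : measurable_fun setT f ->
  measurable_fun setT g -> measurable_fun setT h -> 0 <= a -> 0 <= b ->
  (forall x, h x ^+ 2 <= a * f x ^+ 2 + b * g x ^+ 2) ->
  (sqint h <= a%:E * sqint f + b%:E * sqint g)%E.
Proof.
move=> mf mg mh a0 b0 hle.
have m2 (k : T -> R) : measurable_fun setT k -> measurable_fun setT (fun x => (k x ^+ 2)%:E).
  by move=> mk; apply/measurable_EFinP; exact: measurable_funX.
have p2 (c : R) (k : T -> R) x : 0 <= c -> (0 <= c%:E * (k x ^+ 2)%:E)%E.
  by move=> c0; rewrite -EFinM lee_fin mulr_ge0 ?sqr_ge0.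
apply: (@le_trans _ _
    (\int[mu]_x (a%:E * (f x ^+ 2)%:E + b%:E * (g x ^+ 2)%:E))%E).
  apply: ge0_le_integral => //=.
  - by move=> x _; rewrite lee_fin sqr_ge0.
  - exact: m2.
  - by apply: emeasurable_funD; apply: measurable_funeM; exact: m2.
  - by move=> x _; rewrite -!EFinM -EFinD lee_fin.
rewrite ge0_integralD//=.
- rewrite !ge0_integralZl_EFin//; (try exact: m2); by move=> x _; rewrite lee_fin sqr_ge0.
- by move=> x _; exact: p2.
- by apply: measurable_funeM; exact: m2.
- by move=> x _; exact: p2.
- by apply: measurable_funeM; exact: m2.
Qed.

End rintegrable_theory.

Section normal_moments.
Context (R : realType).

Lemma integral_normal_prob (m s : R) (f : R -> R) : s != 0 ->
  measurable_fun setT f -> (forall x, 0 <= f x) ->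
  (\int[normal_prob m s]_x (f x)%:E)%E =
  (\int[lebesgue_measure]_x (f x * normal_pdf m s x)%:E)%E.
Proof.
move=> s0 mf f0.
have dom := normal_prob_dominates m s.
rewrite -(Radon_Nikodym_SigmaFinite.change_of_variables dom)//; last exact/measurable_EFinP.
have mRN : measurable_fun setT
    (Radon_Nikodym_SigmaFinite.f (normal_prob m s) lebesgue_measure).
  by apply: (measurable_int lebesgue_measure);
    exact: Radon_Nikodym_SigmaFinite.f_integrable.
under [RHS]eq_integral do rewrite EFinM.
apply: ae_eq_integral => //.
- by apply: emeasurable_funM => //; exact/measurable_EFinP.
- apply: emeasurable_funM; first exact/measurable_EFinP.
  by apply/measurable_EFinP; exact: measurable_normal_pdf.
(* The Radon-Nikodym derivative and the explicit density have the same integral over every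
   measurable set, hence agree almost everywhere. *)
- apply: ae_eqe_mul2l; apply: integral_ae_eq => //.
  + exact: Radon_Nikodym_SigmaFinite.f_integrable.
  + by apply/measurable_EFinP; exact: measurable_normal_pdf.
  + by move=> E _ mE; rewrite -Radon_Nikodym_SigmaFinite.f_integral.
Qed.

(* Completing the square: [expR (t x)] times the density of N(0, s^2) is
   [expR (t^2 s^2 / 2)] times the density of N(t s^2, s^2). *)
Lemma normal_mgf (s t : R) : s != 0 ->
  (\int[normal_prob 0 s]_x (expR (t * x))%:E)%E =
  (expR (t ^+ 2 * s ^+ 2 / 2))%:E.
Proof.
move=> s0.
rewrite integral_normal_prob//; last first.
  by apply: measurableT_comp => //; exact: measurable_funM.
under eq_integral => x _.
  rewrite (_ : _ * _ = expR (t ^+ 2 * s ^+ 2 / 2) * normal_pdf (t * s ^+ 2) s x).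
    rewrite EFinM; over.
  rewrite !normal_pdfE// /normal_fun mulrCA [RHS]mulrCA -!expRD.
  by congr (_ * expR _); rewrite -mulr_natr; field.
rewrite integralZl//=; last exact: integrable_normal_pdf.
by rewrite integral_normal_pdf mule1.
Qed.

End normal_moments.

(** * Difference quotients of the exponential at 0 *)

Section exp_slope.
Context (R : realType).
Implicit Types y z N : R.

Lemma expR_sub1_le z : `|expR z - 1| <= `|z| * expR `|z|.
Proof.
have h1 := expR_ge1Dx z; have h2 := expR_ge1Dx (- z).
have e0 := expR_gt0 z; have := expRxMexpNx_1 z.
have := expR_gt0 (- z) => e1 e2.
have [z0|z0] := leP 0 z.
  rewrite ger0_norm; last by lra.
  rewrite ger0_norm//; nra.
rewrite ltr0_norm ?subr_lt0 ?expR_lt1// (ltr0_norm z0).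
have : 1 <= expR (- z) by rewrite -expR0 ler_expR; lra.
by move=> e3; nra.
Qed.

Lemma expR_sub1_sub_le z : `|expR z - 1 - z| <= z ^+ 2 * expR `|z|.
Proof.
have h1 := expR_ge1Dx z; have h2 := expR_ge1Dx (- z).
have e0 := expR_gt0 z; have e2 := expRxMexpNx_1 z.
rewrite ger0_norm; last by lra.
have : expR z - 1 - z <= z * (expR z - 1) by nra.
move=> /le_trans; apply; rewrite (le_trans (ler_norm _))// normrM.
have -> : z ^+ 2 = `|z| * `|z| by rewrite -normrM -expr2 ger0_norm// sqr_ge0.
by rewrite -mulrA ler_wpM2l// expR_sub1_le.
Qed.

(** The bound is uniform in [N] and so can serve as a dominating function. The factor 2 absorbs the
    linear term through [|y| <= exp |y|]. *)
Lemma expR_slope_le y N : 1 <= N -> `|N * (expR (y / N) - 1)| <= expR (2 * `|y|).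
Proof.
move=> N1; have N0 : 0 < N by lra.
rewrite normrM (gtr0_norm N0).
have yN : `|y / N| <= `|y|.
  by rewrite normrM normfV (gtr0_norm N0) ler_piMr// invf_le1.
have : N * `|expR (y / N) - 1| <= `|y| * expR `|y|.
  rewrite (le_trans (ler_wpM2l (ltW N0) (expR_sub1_le _)))// mulrA.
  apply: ler_pM => //; rewrite ?expR_ge0 ?ler_expR ?mulr_ge0 ?(ltW N0)//.
  by rewrite normrM normfV (gtr0_norm N0) mulrCA divff ?mulr1// gt_eqF.
move=> /le_trans; apply; rewrite mulr_natl mulr2n expRD ler_wpM2r ?expR_ge0//.
by have := expR_ge1Dx `|y|; lra.
Qed.

(** The scale is left free because it is used both with [n.+1], on a function itself, and with its
    square, on a Laplace transform. *)
Lemma cvg_expR_slope y (N : nat -> R) : (forall n, n.+1%:R <= N n) ->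
  N n * (expR (y / N n) - 1) @[n --> \oo] --> y.
Proof.
move=> hN; apply/subr_cvg0.
apply/norm_cvg0P.
have C : (y ^+ 2 * expR `|y|) * n.+1%:R^-1 @[n --> \oo] --> 0.
  rewrite -[X in _ --> X](mulr0 (y ^+ 2 * expR `|y|)).
  by apply: cvgM; [exact: cvg_cst|exact: cvg_harmonic].
apply: (squeeze_cvgr _ (cvg_cst 0) C).
near=> n.
rewrite normr_ge0/=.
have N1 : 1 <= N n by rewrite (le_trans _ (hN n))// ler1n.
have N0 : 0 < N n by lra.
have yN : `|y / N n| <= `|y|.
  by rewrite normrM normfV (gtr0_norm N0) ler_piMr// invf_le1.
have -> : N n * (expR (y / N n) - 1) - y = N n * (expR (y / N n) - 1 - y / N n).
  by field; rewrite gt_eqF.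
rewrite normrM (gtr0_norm N0).
rewrite (le_trans (ler_wpM2l (ltW N0) (expR_sub1_sub_le _)))//.
have -> : N n * ((y / N n) ^+ 2 * expR `|y / N n|) =
    y ^+ 2 * expR `|y / N n| * (N n)^-1 by field; rewrite gt_eqF.
apply: ler_pM => //.
- by rewrite mulr_ge0 ?sqr_ge0 ?expR_ge0.
- by rewrite invr_ge0 ltW.
- by rewrite ler_wpM2l ?sqr_ge0// ler_expR.
- by rewrite lef_pV2 ?posrE//.
Unshelve. all: by end_near.
Qed.

Lemma expR_norm_le y : expR `|y| <= expR y + expR (- y).
Proof.
by have [y0|y0] := ger0P y; rewrite (lerDl,lerDr) expR_ge0.
Qed.

End exp_slope.

Section gaussian_mgf.
Context d (T : measurableType d) (R : realType) (P : probability T R).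

Lemma Rintegral1 : \int[P]_x 1 = 1 :> R.
Proof.
by rewrite Rintegral_cst// mul1r; exact: (congr1 fine (@probability_setT _ _ _ P)).
Qed.

(** [X] is the limit of [N * (exp (X / N) - 1)], whose square is a combination of exponentials with
    known integrals. The case [s = 0] is included, which covers the Dirac mass. *)
Lemma second_moment_of_mgf (X : T -> R) (s : R) : measurable_fun setT X ->
  (forall t, (\int[P]_x (expR (t * X x))%:E)%E =
             (expR (t ^+ 2 * s ^+ 2 / 2))%:E) ->
  rintegrable P (fun x => X x ^+ 2) /\ \int[P]_x (X x ^+ 2) = s ^+ 2.
Proof.
move=> mX mgf.
have mexp t : measurable_fun setT (fun x => expR (t * X x)).
  by apply: measurableT_comp => //; exact: measurable_funM.
have iexp t : rintegrable P (fun x => expR (t * X x)).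
  by apply: rintegrable_ge0 => //; rewrite mgf ltry.
have Rmgf t : \int[P]_x expR (t * X x) = expR (t ^+ 2 * s ^+ 2 / 2).
  by rewrite /Rintegral mgf.
have i1 : rintegrable P (fun=> 1 : R) by exact: finite_measure_integrable_cst.
pose u (n : nat) (x : T) : R := (n.+1%:R * (expR (X x / n.+1%:R) - 1)) ^+ 2.
have uE n x : u n x = n.+1%:R ^+ 2 * (expR (2 / n.+1%:R * X x) +
    ((- 2) * expR (n.+1%:R^-1 * X x) + 1)).
  rewrite /u exprMn; congr (_ * _).
  have -> : 2 / n.+1%:R * X x = n.+1%:R^-1 * X x + n.+1%:R^-1 * X x by ring.
  by rewrite expRD mulrC; ring.
have mu_ n : measurable_fun setT (u n).
  rewrite (funext (uE n)).
  apply: measurable_funM => //; apply: measurable_funD => //.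
  by apply: measurable_funD => //; exact: measurable_funM.
have [|||iX cX] := @dominated_Rintegral _ T R P u (fun x => X x ^+ 2)
    (fun x => expR (4 * X x) + expR ((- 4) * X x)) mu_.
- move=> x; rewrite expr2; under eq_cvg do rewrite /u expr2.
  by apply: cvgM; apply: cvg_expR_slope.
(* Squaring [exp (2 |X|)] gives [exp (4 |X|)], dominated by two exponentials of [X] without absolute
   value. *)
- move=> n x; rewrite ger0_norm ?sqr_ge0//.
  have h := @expR_slope_le R (X x) n.+1%:R _.
  rewrite (@le_trans _ _ (expR (2 * `|X x|) ^+ 2))//.
    by rewrite -ler_sqrt ?sqr_ge0// !sqrtr_sqr (ger0_norm (expR_ge0 _)) h// ler1n.
  rewrite expr2 -expRD.
  have -> : 2 * `|X x| + 2 * `|X x| = `|4 * X x|.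
    by rewrite normrM (ger0_norm (ler0n _ 4)); ring.
  by rewrite mulNr; exact: expR_norm_le.
- exact: rintegrableD.
split => //.
(* The constant 1 is distributed so as to form two difference quotients at scale [n.+1 ^ 2]; their
   limits are [2 * s ^+ 2] and [s ^+ 2 / 2], whence the value [s ^+ 2]. *)
have iu n : \int[P]_x u n x =
    n.+1%:R ^+ 2 * (expR ((2 * s ^+ 2) / n.+1%:R ^+ 2) - 1) -
    2 * (n.+1%:R ^+ 2 * (expR ((s ^+ 2 / 2) / n.+1%:R ^+ 2) - 1)).
  under eq_Rintegral do rewrite uE.
  have i2 := rintegrableZ (-2) (iexp n.+1%:R^-1).
  have i3 := rintegrableD i2 i1.
  rewrite (RintegrableZ _ (rintegrableD (iexp _) i3)) (RintegrableD (iexp _) i3).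
  rewrite (RintegrableD i2 i1) (RintegrableZ _ (iexp _)) !Rmgf Rintegral1.
  have -> : (2 / n.+1%:R) ^+ 2 * s ^+ 2 / 2 = 2 * s ^+ 2 / n.+1%:R ^+ 2 :> R.
    by field.
  have -> : n.+1%:R^-1 ^+ 2 * s ^+ 2 / 2 = s ^+ 2 / 2 / n.+1%:R ^+ 2 :> R.
    by field.
  by ring.
have lim2 : \int[P]_x u n x @[n --> \oo] --> s ^+ 2.
  rewrite (funext iu).
  rewrite [X in _ --> X](_ : _ = 2 * s ^+ 2 - 2 * (s ^+ 2 / 2)); last by field.
  have hN n : n.+1%:R <= (n.+1%:R ^+ 2 : R).
    by rewrite -natrX ler_nat leq_pmulr.
  apply: cvgB; last (apply: cvgM; first exact: cvg_cst).
    exact: (@cvg_expR_slope R (2 * s ^+ 2) (fun n => n.+1%:R ^+ 2)).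
  exact: (@cvg_expR_slope R (s ^+ 2 / 2) (fun n => n.+1%:R ^+ 2)).
exact: cvg_unique cX lim2.
Qed.

End gaussian_mgf.

(** * Density of exponentials in L^2 *)

Definition tdot (R : realType) (n : nat) (a : 'I_n -> R) (x : n.-tuple R) : R :=
  \sum_(i < n) a i * tnth x i.

Definition tnorm1 (R : realType) (n : nat) (x : n.-tuple R) : R :=
  \sum_(i < n) `|tnth x i|.

Definition expsum (R : realType) (n : nat) (s : seq (R * ('I_n -> R)))
  (x : n.-tuple R) : R :=
  \sum_(p <- s) p.1 * expR (tdot p.2 x).

(* The smallest class that contains the exponentials and is stable under linear
   combinations and exponentially dominated pointwise limits.  It is an algebra
   and every element is an L^2 limit of exponential sums. *)
Inductive exp_closure (R : realType) (n : nat) : (n.-tuple R -> R) -> Prop :=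
| exp_closure_exp a : exp_closure (fun x => expR (tdot a x))
| exp_closure_lin c f g : exp_closure f -> exp_closure g ->
    exp_closure (fun x => c * f x + g x)
| exp_closure_lim u f C K : (forall k, exp_closure (u k)) ->
    (forall k x, `|u k x| <= C * expR (K * tnorm1 x)) ->
    (forall x, u k x @[k --> \oo] --> f x) -> exp_closure f.

Section exp_closure_theory.
Context (R : realType) (n : nat).
Local Notation T := (n.-tuple R).
Implicit Types (f g : T -> R) (a : 'I_n -> R) (x : T).

Lemma measurable_tdot a : measurable_fun setT (tdot a).
Proof.
apply: measurable_sum => i; apply: measurable_funM => //.
exact: measurable_tnth.
Qed.

Lemma measurable_expR_tdot a : measurable_fun setT (fun x => expR (tdot a x)).
Proof. by apply: measurableT_comp => //; exact: measurable_tdot. Qed.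

Lemma measurable_expsum s : measurable_fun setT (@expsum R n s).
Proof.
apply: measurable_sum => i; apply: measurable_funM => //.
exact: measurable_expR_tdot.
Qed.

Lemma tnorm1_ge0 x : 0 <= tnorm1 x.
Proof. exact: sumr_ge0. Qed.

Lemma tdot_le a x : `|tdot a x| <= (\sum_i `|a i|) * tnorm1 x.
Proof.
rewrite (le_trans (ler_norm_sum _ _ _))// mulr_suml ler_sum// => i _.
rewrite normrM ler_wpM2l// /tnorm1 (bigD1 i)//= lerDl sumr_ge0//.
Qed.

Lemma expR_tdot_le a x :
  expR (tdot a x) <= expR ((\sum_i `|a i|) * tnorm1 x).
Proof. by rewrite ler_expR (le_trans (ler_norm _))// tdot_le. Qed.

Lemma tdotD a b x : tdot (fun i => a i + b i) x = tdot a x + tdot b x.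
Proof. by rewrite -big_split; apply: eq_bigr => i _; rewrite /= mulrDl. Qed.

Lemma tdotZ c a x : tdot (fun i => c * a i) x = c * tdot a x.
Proof. by rewrite mulr_sumr; apply: eq_bigr => i _; rewrite mulrA. Qed.

Lemma tdot0 x : tdot (fun=> 0) x = 0.
Proof. by rewrite /tdot big1// => i _; rewrite mul0r. Qed.

(** Exponential growth passes through the induction; it supplies the domination needed when a limit
    is multiplied by a fixed element. *)
Lemma exp_closure_bound f : exp_closure f ->
  exists C K : R, [/\ 0 <= C, 0 <= K &
    forall x, `|f x| <= C * expR (K * tnorm1 x)].
Proof.
elim=> [a|c {}f g _ [C [K [C0 K0 fC]]] _ [D [L [D0 L0 gD]]]|u {}f C K _ _ uC uf].
- exists 1, (\sum_i `|a i|); split => //; first exact: sumr_ge0.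
  by move=> x; rewrite mul1r ger0_norm ?expR_ge0// expR_tdot_le.
- exists (`|c| * C + D), (K + L); split; rewrite ?addr_ge0 ?mulr_ge0// => x.
  rewrite (le_trans (ler_normD _ _))// mulrDl lerD//.
    rewrite normrM -mulrA ler_wpM2l// (le_trans (fC x))// ler_wpM2l//.
    by rewrite ler_expR ler_wpM2r ?tnorm1_ge0// lerDl.
  rewrite (le_trans (gD x))// ler_wpM2l//.
  by rewrite ler_expR ler_wpM2r ?tnorm1_ge0// lerDr.
(* The limit constructor puts no sign condition on its constants. *)
- exists `|C|, `|K|; split => // x.
  have h k : `|u k x| <= `|C| * expR (`|K| * tnorm1 x).
    rewrite (le_trans (uC k x))// ler_pM ?expR_ge0 ?ler_norm//.
    + by rewrite -(pmulr_lge0 _ (expR_gt0 (K * tnorm1 x))) (le_trans _ (uC k x)).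
    + by rewrite ler_expR ler_wpM2r ?tnorm1_ge0// ler_norm.
  by apply: (cvgr_to_le (cvg_norm (uf x))); near=> k; exact: h.
Unshelve. all: by end_near.
Qed.

Lemma exp_closure_expM a f : exp_closure f ->
  exp_closure (fun x => f x * expR (tdot a x)).
Proof.
elim=> [b|c {}f g _ hf _ hg|u {}f C K _ hu uC uf].
- rewrite (_ : (fun _ => _) = fun x => expR (tdot (fun i => b i + a i) x)).
    exact: exp_closure_exp.
  by apply/funext => x; rewrite tdotD expRD.
- rewrite (_ : (fun _ => _) = fun x => c * (f x * expR (tdot a x)) +
      g x * expR (tdot a x)); first exact: exp_closure_lin.
  by apply/funext => x; rewrite mulrDl mulrA.
- apply: (@exp_closure_lim _ _ (fun k x => u k x * expR (tdot a x)) _ C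
    (K + \sum_i `|a i|)) => //.
    move=> k x; rewrite normrM mulrDl expRD mulrA ler_pM// ger0_norm ?expR_ge0//.
    exact: expR_tdot_le.
  by move=> x; apply: cvgM; [exact: uf|exact: cvg_cst].
Qed.

(** Induction on [f] with [g] fixed. The base case multiplies by one exponential, which is an
    induction on [g]; in the limit case the growth bound of [g] multiplies the envelope of the
    sequence. *)
Lemma exp_closureM f g : exp_closure f -> exp_closure g ->
  exp_closure (fun x => f x * g x).
Proof.
move=> + hg; have [D [L [D0 L0 gD]]] := exp_closure_bound hg.
elim=> [a|c {}f f' _ hf _ hf'|u {}f C K _ hu uC uf].
- by under eq_fun do rewrite mulrC; exact: exp_closure_expM.
- rewrite (_ : (fun _ => _) = fun x => c * (f x * g x) + f' x * g x).
    exact: exp_closure_lin.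
  by apply/funext => x; rewrite mulrDl mulrA.
- apply: (@exp_closure_lim _ _ (fun k x => u k x * g x) _ (C * D) (K + L)) => //.
    by move=> k x; rewrite normrM mulrDl expRD mulrACA ler_pM.
  by move=> x; apply: cvgM; [exact: uf|exact: cvg_cst].
Qed.

Lemma exp_closure_cst c : exp_closure (fun _ : T => c).
Proof.
have h : exp_closure (fun _ : T => 1).
  rewrite (_ : (fun _ => _) = fun x => expR (tdot (fun=> 0) x)).
    exact: exp_closure_exp.
  by apply/funext => x; rewrite tdot0 expR0.
(* The combination rule scales only its first argument, and 1 is the only constant available so
   far. *)
rewrite (_ : (fun _ => _) = fun x => (c - 1) * 1 + 1).
  exact: exp_closure_lin.
by apply/funext => x; rewrite mulr1 subrK.
Qed.

Lemma exp_closureZ c f : exp_closure f -> exp_closure (fun x => c * f x).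
Proof.
move=> hf; rewrite (_ : (fun _ => _) = fun x => c * f x + 0).
  by apply: exp_closure_lin => //; exact: exp_closure_cst.
by apply/funext => x; rewrite addr0.
Qed.

Lemma exp_closureD f g : exp_closure f -> exp_closure g ->
  exp_closure (fun x => f x + g x).
Proof.
move=> hf hg; rewrite (_ : (fun _ => _) = fun x => 1 * f x + g x).
  exact: exp_closure_lin.
by apply/funext => x; rewrite mul1r.
Qed.

Lemma exp_closure_sum I (s : seq I) (h : I -> T -> R) :
  (forall i, exp_closure (h i)) -> exp_closure (fun x => \sum_(i <- s) h i x).
Proof.
move=> hi; elim: s => [|i s IH].
  by under eq_fun do rewrite big_nil; exact: exp_closure_cst.
by under eq_fun do rewrite big_cons; exact: exp_closureD.
Qed.

Lemma exp_closureX f k : exp_closure f -> exp_closure (fun x => f x ^+ k).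
Proof.
move=> hf; elim: k => [|k IH]; first exact: exp_closure_cst.
by under eq_fun do rewrite exprS; exact: exp_closureM.
Qed.

End exp_closure_theory.

Section L2_approx.
Context (R : realType) (n : nat) (mu : probability (n.-tuple R) R).
Hypothesis mu_exp : forall a, rintegrable mu (fun x => expR (tdot a x)).
Local Notation T := (n.-tuple R).
Implicit Types f g : T -> R.

(** [exp (K |t|) <= exp (K t) + exp (- K t)] in each coordinate; expanding the product over
    coordinates gives a sum, over sign patterns, of exponentials of linear forms. *)
Lemma rintegrable_expR_tnorm1 (C K : R) :
  rintegrable mu (fun x => C * expR (K * tnorm1 x)).
Proof.
apply: rintegrableZ.
pose sg (b : bool) : R := (-1) ^+ b * K.
apply: (@rintegrable_le _ _ _ _ _ (fun x => \sum_(f : {ffun 'I_n -> bool})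
    expR (tdot (fun i => sg (f i)) x))).
- apply: measurableT_comp => //; apply: measurable_funM => //.
  apply: measurable_sum => i; apply: measurableT_comp => //.
  exact: measurable_tnth.
- move=> x; rewrite ger0_norm ?expR_ge0//.
  rewrite /tnorm1 mulr_sumr expR_sum.
  have -> : \sum_(f : {ffun 'I_n -> bool}) expR (tdot (fun i => sg (f i)) x) =
      \prod_i \sum_(b : bool) expR (sg b * tnth x i).
    rewrite bigA_distr_bigA/=; apply: eq_bigr => f _.
    by rewrite /tdot expR_sum.
  apply: ler_prod => i _; rewrite expR_ge0/= big_bool/= /sg expr1 expr0 mul1r.
  rewrite mulN1r mulNr; have [x0|x0] := ger0P (tnth x i).
    by rewrite lerDr expR_ge0.
  by rewrite mulrN lerDl expR_ge0.
- by apply: rintegrable_sum => f; exact: mu_exp.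
Qed.

Definition exp_approximable f := measurable_fun setT f /\
  forall e : R, 0 < e -> exists s,
    (sqint mu (fun x => (f x - expsum s x)%R) <= e%:E)%E.

Lemma exp_approximable_lin c f g : exp_approximable f -> exp_approximable g ->
  exp_approximable (fun x => c * f x + g x).
Proof.
move=> [mf hf] [mg hg]; split.
  by apply: measurable_funD => //; exact: measurable_funM.
move=> e e0.
(* [k] majorizes both coefficients in [(c A + B)^2 <= 2 c^2 A^2 + 2 B^2], so a tolerance
   [e / (2 * k)] on each error suffices. *)
pose k := 2 * c ^+ 2 + 2.
have k0 : 0 < k by rewrite ltr_wpDl// mulr_ge0// sqr_ge0.
have ek : 0 < e / (2 * k) by rewrite divr_gt0// mulr_gt0.
have [s1 h1] := hf _ ek; have [s2 h2] := hg _ ek.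
exists ([seq (c * p.1, p.2) | p <- s1] ++ s2).
have m1 := measurable_expsum s1; have m2 := measurable_expsum s2.
have -> : (fun x => c * f x + g x -
      expsum ([seq (c * p.1, p.2) | p <- s1] ++ s2) x) =
    (fun x => c * (f x - expsum s1 x) + (g x - expsum s2 x)).
  apply/funext => x; rewrite {1}/expsum big_cat big_map/=.
  have -> : \sum_(j <- s1) c * j.1 * expR (tdot j.2 x) = c * expsum s1 x.
    by rewrite mulr_sumr; apply: eq_bigr => j _; rewrite mulrA.
  by rewrite -/(expsum s2 x); ring.
apply: (le_trans (@sqint_le _ _ _ mu (fun x => f x - expsum s1 x)
  (fun x => g x - expsum s2 x) _ k k _ _ _ _ _ _)).
- exact: measurable_funB.
- exact: measurable_funB.
- by apply: measurable_funD => //; [apply: measurable_funM => //|];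
    exact: measurable_funB.
- exact: ltW.
- exact: ltW.
- move=> x; set A := f x - expsum s1 x; set B := g x - expsum s2 x.
  have := sqr_ge0 (c * A - B); have := sqr_ge0 (c * B); have := sqr_ge0 A.
  by rewrite /k; nra.
rewrite (@le_trans _ _ (k%:E * (e / (2 * k))%:E + k%:E * (e / (2 * k))%:E)%E)//.
  by apply: leeD; apply: lee_wpmul2l => //; rewrite lee_fin ltW.
rewrite -!EFinM -EFinD lee_fin le_eqVlt; apply/orP; left; apply/eqP.
by field; rewrite gt_eqF.
Qed.

(** [(f - u k)^2] is dominated by [4 * g ^+ 2], so [u k] tends to [f] in L^2; an exponential sum
    close to one such [u k] is then close to [f]. *)
Lemma exp_approximable_lim (u : nat -> T -> R) f g :
  (forall k, exp_approximable (u k)) ->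
  (forall k x, `|u k x| <= g x) -> rintegrable mu (fun x => g x ^+ 2) ->
  (forall x, u k x @[k --> \oo] --> f x) -> exp_approximable f.
Proof.
move=> hu ug ig uf.
have mf : measurable_fun setT f.
  by apply: (@measurable_fun_cvg _ _ _ setT u) => [k|x _];
    [exact: (hu k).1|exact: uf].
split => // e e0.
have fg x : `|f x| <= g x.
  by apply: (cvgr_to_le (cvg_norm (uf x))); near=> k; exact: ug.
have md k : measurable_fun setT (fun x => (f x - u k x) ^+ 2).
  by apply: measurable_funX; apply: measurable_funB => //; exact: (hu k).1.
have dle k x : `|(f x - u k x) ^+ 2| <= 4 * g x ^+ 2.
  rewrite ger0_norm ?sqr_ge0//.
  have := fg x; have := ug k x; rewrite !ler_norml => /andP[? ?] /andP[? ?].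
  by nra.
have ig4 := rintegrableZ 4 ig.
have [|_] := dominated_Rintegral (f := fun=> 0) md _ dle ig4.
  move=> x; rewrite [X in _ --> X](_ : _ = (f x - f x) * (f x - f x)).
    by apply: cvgM; (apply: cvgB; [exact: cvg_cst|exact: uf]).
  by rewrite subrr mul0r.
rewrite Rintegral_cst// mul0r => lim0.
have e4 : 0 < e / 4 by rewrite divr_gt0.
have [k _ /(_ k (leqnn k)) hk] := cvgr_le _ lim0 _ e4.
have [s hs] := (hu k).2 _ e4.
have ms := measurable_expsum s.
exists s.
apply: (le_trans (@sqint_le _ _ _ mu (fun x => f x - u k x)
  (fun x => u k x - expsum s x) _ 2 2 _ _ _ _ _ _)) => //.
- by apply: measurable_funB => //; exact: (hu k).1.
- by apply: measurable_funB => //; exact: (hu k).1.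
- exact: measurable_funB.
- move=> x; have := sqr_ge0 (f x - u k x - (u k x - expsum s x)).
  by nra.
have hk' : (sqint mu (fun x => (f x - u k x)%R) <= (e / 4)%:E)%E.
  by rewrite /sqint EFin_Rintegral ?lee_fin//; exact: rintegrable_le (md k) (dle k) ig4.
rewrite (@le_trans _ _ (2%:E * (e / 4)%:E + 2%:E * (e / 4)%:E)%E)//.
  by apply: leeD; apply: lee_wpmul2l.
rewrite -!EFinM -EFinD lee_fin le_eqVlt; apply/orP; left; apply/eqP.
by field.
Unshelve. all: by end_near.
Qed.

Lemma exp_closure_approximable f : exp_closure f -> exp_approximable f.
Proof.
elim=> [a|c {}f g _ hf _ hg|u {}f C K _ hu uC uf].
- split=> [|e e0]; first exact: measurable_expR_tdot.
  exists [:: (1, a)]; rewrite /sqint.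
  under eq_integral do rewrite /expsum big_seq1 mul1r subrr expr0n.
  by rewrite integral0 lee_fin ltW.
- exact: exp_approximable_lin.
- apply: (exp_approximable_lim hu uC _ uf).
  rewrite (_ : (fun _ => _) = fun x => C ^+ 2 * expR ((2 * K) * tnorm1 x)).
    exact: rintegrable_expR_tnorm1.
  apply/funext => x; rewrite exprMn; congr (_ * _).
  by rewrite expr2 -expRD; congr expR; ring.
Qed.

End L2_approx.

(** * Taylor sums of the sine, and polynomial iterations converging to the sign *)

Section real_sequences.
Context (R : realType).
Implicit Types y z : R.

Lemma series_sin_coeff_le z k : `|series (sin_coeff z) k| <= expR `|z|.
Proof.
have nd : nondecreasing_seq (series (exp_coeff `|z|)).
  by apply: nondecreasing_series => i _ _; exact: exp_coeff_ge0.
have cv := is_cvg_series_exp_coeff `|z|.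
rewrite (le_trans _ (nondecreasing_cvgn_le nd cv k))//.
rewrite !seriesEnat/= (le_trans (ler_norm_sum _ _ _))// ler_sum// => i _.
rewrite /exp_coeff/= !normrM normfV normrX ger0_norm// (ger0_norm (ler0n _ i`!)).
rewrite ler_wpM2r ?invr_ge0// normrX normrN1 expr1n mulr1.
by case: (odd i); rewrite ?mul1r// mul0r exprn_ge0.
Qed.

(** The Newton-Schulz iteration for the sign function: it preserves [[-1, 1]], fixes -1, 0 and 1,
    and, being polynomial, preserves any algebra of functions. *)
Definition sign_step z := (3 * z - z ^+ 3) / 2.

Lemma sign_stepN z : sign_step (- z) = - sign_step z.
Proof. by rewrite /sign_step; ring. Qed.

Lemma sign_step_le1 z : `|z| <= 1 -> `|sign_step z| <= 1.
Proof.
rewrite !ler_norml => /andP[h1 h2]; rewrite /sign_step; apply/andP; split.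
  rewrite -subr_ge0 (_ : _ - _ = (1 + z) ^+ 2 * (2 - z) / 2); last by field.
  by rewrite divr_ge0// mulr_ge0 ?sqr_ge0//; lra.
rewrite -subr_ge0 (_ : _ - _ = (1 - z) ^+ 2 * (2 + z) / 2); last by field.
by rewrite divr_ge0// mulr_ge0 ?sqr_ge0//; lra.
Qed.

Lemma iter_sign_step_le1 z k : `|z| <= 1 -> `|iter k sign_step z| <= 1.
Proof. by move=> z1; elim: k => //= k; exact: sign_step_le1. Qed.

(** One step multiplies [1 - w] by [1 - w / 2 - w ^+ 2 / 2]. The iterates stay above [z], so this
    factor is at most [1 - z / 2]. *)
Lemma iter_sign_step_rate z k : 0 < z <= 1 ->
  [/\ z <= iter k sign_step z, iter k sign_step z <= 1 &
      1 - iter k sign_step z <= (1 - z / 2) ^+ k].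
Proof.
move=> /andP[z0 z1]; elim: k => [|k [h1 h2 h3]]; first by split => //=; lra.
rewrite iterS; set w := iter k sign_step z in h1 h2 h3 *.
have w0 : 0 < w by lra.
split.
- rewrite (le_trans h1)// /sign_step -subr_ge0.
  rewrite (_ : _ - _ = w * (1 - w) * (1 + w) / 2); last by field.
  by rewrite divr_ge0// !mulr_ge0//; lra.
- by rewrite (le_trans (ler_norm _))// sign_step_le1// ger0_norm// ltW.
- rewrite exprS (_ : 1 - sign_step w = (1 - w / 2 - w ^+ 2 / 2) * (1 - w)).
    by apply: ler_pM => //; nra.
  by rewrite /sign_step; field.
Qed.

Lemma cvg_iter_sign_step z : `|z| <= 1 ->
  iter k sign_step z @[k --> \oo] --> Num.sg z.
Proof.
have pos y : 0 < y <= 1 -> iter k sign_step y @[k --> \oo] --> (1 : R).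
  move=> /[dup] y01 /andP[y0 y1].
  have c : 1 - (1 - y / 2) ^+ k @[k --> \oo] --> (1 : R).
    rewrite -[X in _ --> X]subr0; apply: cvgB; first exact: cvg_cst.
    by apply: cvg_expr; rewrite ger0_norm; lra.
  apply: squeeze_cvgr c (cvg_cst _); near=> k.
  by have [? ? ?] := iter_sign_step_rate k y01; apply/andP; split => //; lra.
move=> z1; have [z0|z0|->] := ltgtP z 0.
- rewrite ltr0_sg//.
  have -> : (fun k => iter k sign_step z) = (fun k => - iter k sign_step (- z)).
    apply/funext; elim => [|k IH] /=; first by rewrite opprK.
    by rewrite IH sign_stepN.
  by apply: cvgN; apply: pos; move: z1; rewrite ltr0_norm//; lra.
- by rewrite gtr0_sg//; apply: pos; move: z1; rewrite gtr0_norm//; lra.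
- rewrite sgr0; have -> : (fun k => iter k sign_step 0) = (fun=> 0).
    apply/funext; elim => //= k ->.
    by rewrite /sign_step expr0n mulr0 subr0 mul0r.
  exact: cvg_cst.
Unshelve. all: by end_near.
Qed.

(** The sequence is eventually constant: once [k >= |y|], the argument lies strictly between -1 and
    1, where the sine has the sign of its argument. *)
Lemma cvg_sg_sin y : Num.sg (sin (y / k.+1%:R)) @[k --> \oo] --> Num.sg y.
Proof.
apply: cvg_near_cst; near=> k.
have yk : `|y| <= k%:R by near: k; exact: nbhs_infty_ger.
have k0 : 0 < k.+1%:R :> R by rewrite ltr0n.
have pos (w : R) : 0 < w -> w <= k%:R -> 0 < sin (w / k.+1%:R).
  move=> w0 wk; apply: sin_gt0_pi; rewrite divr_gt0//=.
  rewrite (@lt_le_trans _ _ 1)//; last by rewrite (le_trans _ (pi_ge2 R))// ler1n.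
  by rewrite ltr_pdivrMr// mul1r (le_lt_trans wk)// ltr_nat.
apply/eqP; have [y0|y0|->] := ltgtP y 0.
- rewrite (ltr0_sg y0) -(opprK y) mulNr sinN ltr0_sg// oppr_lt0 pos ?oppr_gt0//.
  by move: yk; rewrite ltr0_norm.
- rewrite (gtr0_sg y0) gtr0_sg// pos//.
  by move: yk; rewrite gtr0_norm.
- by rewrite mul0r sin0.
Unshelve. all: by end_near.
Qed.

End real_sequences.

(** * From exponentials to Borel indicators and square integrable functions *)

Section exp_closure_measurable_functions.
Context (R : realType) (n : nat).
Local Notation T := (n.-tuple R).
Implicit Types (f g : T -> R) (a : 'I_n -> R) (x : T) (A : set T).

Lemma exp_closure_blim (u : nat -> T -> R) f (C : R) :
  (forall k, exp_closure (u k)) -> (forall k x, `|u k x| <= C) ->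
  (forall x, u k x @[k --> \oo] --> f x) -> exp_closure f.
Proof.
move=> hu uC uf; apply: (exp_closure_lim (C := C) (K := 0) hu _ uf) => k x.
by rewrite mul0r expR0 mulr1.
Qed.

(** A linear form is the derivative at 0 of [t |-> exp (t (a . x))], hence a dominated limit of
    difference quotients. *)
Lemma exp_closure_tdot a : exp_closure (tdot a).
Proof.
pose u (k : nat) x : R := k.+1%:R * (expR (tdot a x / k.+1%:R) - 1).
apply: (@exp_closure_lim _ _ u _ 1 (2 * \sum_i `|a i|)).
- move=> k; rewrite (_ : u k = fun x => k.+1%:R *
      expR (tdot (fun i => k.+1%:R^-1 * a i) x) + (- k.+1%:R)).
    by apply: exp_closure_lin; [exact: exp_closure_exp|exact: exp_closure_cst].
  by apply/funext => x; rewrite /u tdotZ (mulrC (tdot a x)); ring.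
- move=> k x; rewrite mul1r (le_trans (expR_slope_le _ _)) ?ler1n//.
  by rewrite ler_expR -mulrA ler_wpM2l// tdot_le.
- by move=> x; exact: cvg_expR_slope.
Qed.

(** The partial sums of the sine series are bounded by [exp |f|]; at most linear growth of [f] makes
    this an admissible envelope. *)
Lemma exp_closure_sin f (C K : R) : exp_closure f ->
  (forall x, `|f x| <= C + K * tnorm1 x) -> exp_closure (fun x => sin (f x)).
Proof.
move=> hf fle.
apply: (@exp_closure_lim _ _ (fun k x => series (sin_coeff (f x)) k) _ (expR C) K).
- move=> k; under eq_fun do rewrite seriesEnat/=.
  apply: exp_closure_sum => i.
  under eq_fun do rewrite /sin_coeff/= mulrAC.
  by apply: exp_closureZ; exact: exp_closureX.
- move=> k x; rewrite (le_trans (series_sin_coeff_le _ _))// -expRD.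
  by rewrite ler_expR.
- by move=> x; rewrite sin.unlock; exact: is_cvg_series_sin_coeff.
Qed.

Lemma exp_closure_sg f : exp_closure f -> (forall x, `|f x| <= 1) ->
  exp_closure (fun x => Num.sg (f x)).
Proof.
move=> hf f1.
apply: (@exp_closure_blim (fun k x => iter k (@sign_step R) (f x)) _ 1).
- elim => [|k IH] //=; rewrite /sign_step.
  rewrite (_ : (fun _ => _) = fun x =>
      (3 / 2) * iter k (@sign_step R) (f x) +
      (- 2^-1) * iter k (@sign_step R) (f x) ^+ 3).
    by apply: exp_closure_lin => //; apply: exp_closureZ; exact: exp_closureX.
  by apply/funext => x; rewrite /sign_step; field.
- by move=> k x; exact: iter_sign_step_le1.
- by move=> x; exact: cvg_iter_sign_step.
Qed.

Definition exp_closure_set A := exp_closure (\1_A : T -> R).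

(* [sin (y / k.+1)] has the sign of [y] for [k] large; unlike [y] it is bounded,
   so that [exp_closure_sg] applies to it. *)
Lemma exp_closure_set_gt (i : 'I_n) (c : R) :
  exp_closure_set [set x | c < tnth x i].
Proof.
pose a (j : 'I_n) : R := (j == i)%:R.
have aE x : tdot a x = tnth x i.
  rewrite /tdot (bigD1 i)//= /a eqxx mul1r big1 ?addr0// => j /negbTE ->.
  by rewrite mul0r.
have hs : exp_closure (fun x => Num.sg (tnth x i - c)).
  apply: (@exp_closure_blim
    (fun k x => Num.sg (sin ((tnth x i - c) / k.+1%:R))) _ 1).
  - move=> k; apply: exp_closure_sg => [|x]; last first.
      by rewrite ler_norml sin_geN1 sin_le1.
    apply: (@exp_closure_sin _ `|c| 1).
      rewrite (_ : (fun _ => _) =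
          fun x => k.+1%:R^-1 * tdot a x + (- c / k.+1%:R)).
        by apply: exp_closure_lin; [exact: exp_closure_tdot|exact: exp_closure_cst].
      by apply/funext => x; rewrite aE; ring.
    move=> x; rewrite normrM normfV (ger0_norm (ler0n _ k.+1)) ler_pdivrMr ?ltr0n//.
    rewrite (@le_trans _ _ (`|c| + 1 * tnorm1 x))//; last first.
      by rewrite ler_peMr ?ler1n// addr_ge0// mulr_ge0// tnorm1_ge0.
    rewrite (le_trans (ler_normB _ _))// addrC lerD2l mul1r.
    by rewrite /tnorm1 (bigD1 i)//= lerDl sumr_ge0.
  - move=> k x; rewrite normr_sg.
    by case: (_ != 0).
  - by move=> x; exact: cvg_sg_sin.
(* [(sg t + sg t ^ 2) / 2] is 1 for [t > 0] and 0 for [t <= 0], the boundary included. *)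
rewrite /exp_closure_set (_ : \1__ = fun x => 2^-1 *
  (Num.sg (tnth x i - c) + Num.sg (tnth x i - c) ^+ 2)).
  by apply: exp_closureZ; apply: exp_closureD => //; exact: exp_closureX.
apply/funext => x; rewrite indicE.
have [xc|xc|xc] := ltgtP c (tnth x i).
- by rewrite mem_set//= gtr0_sg ?subr_gt0//; field.
- by rewrite memNset/=; [rewrite ltr0_sg ?subr_lt0//; field|rewrite /= ltNge (ltW xc)].
- by rewrite memNset/= ?xc ?ltxx// subrr sgr0 expr0n addr0 mulr0.
Qed.

Lemma exp_closure_setC A : exp_closure_set A -> exp_closure_set (~` A).
Proof.
move=> hA; rewrite /exp_closure_set (_ : \1__ = fun x => (-1) * \1_A x + 1).
  by apply: exp_closure_lin => //; exact: exp_closure_cst.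
by apply/funext => x; rewrite !indicE in_setC; case: (x \in A) => /=; ring.
Qed.

Lemma exp_closure_setU A B : exp_closure_set A -> exp_closure_set B ->
  exp_closure_set (A `|` B).
Proof.
move=> hA hB; rewrite /exp_closure_set
  (_ : \1__ = fun x => (-1) * (\1_A x * \1_B x) + (\1_A x + \1_B x)).
  by apply: exp_closure_lin; [exact: exp_closureM|exact: exp_closureD].
by apply/funext => x; rewrite !indicE in_setU;
  case: (x \in A); case: (x \in B) => /=; ring.
Qed.

Lemma exp_closure_set0 : exp_closure_set set0.
Proof. by rewrite /exp_closure_set indic0; exact: exp_closure_cst. Qed.

(** At each point the indicators of the finite unions are eventually constant, and they are bounded
    by 1. *)
Lemma exp_closure_bigcup (F : nat -> set T) :
  (forall k, exp_closure_set (F k)) -> exp_closure_set (\bigcup_k F k).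
Proof.
move=> hF; pose G k := \big[setU/set0]_(i < k) F i.
apply: (@exp_closure_blim (fun k => \1_(G k)) _ 1).
- elim => [|k IH]; first by rewrite /G big_ord0; exact: exp_closure_set0.
  by rewrite /G big_ord_recr; apply: exp_closure_setU.
- by move=> k x; rewrite indicE; case: (_ \in _); rewrite ?normr1 ?normr0.
- move=> x; apply: cvg_near_cst; rewrite indicE.
  have [xF|xF] := pselect ((\bigcup_k F k) x).
    have [m _ Fm] := xF; rewrite mem_set//.
    near=> k; rewrite indicE mem_set// /G -bigcup_mkord.
    by exists m => //=; near: k; exists m.+1.
  rewrite memNset//; near=> k; rewrite indicE memNset// /G -bigcup_mkord.
  by move=> [m _ Fm]; apply: xF; exists m.
Unshelve. all: by end_near.
Qed.

(** The sets with indicator in the closure form a sigma-algebra. It contains the preimages of open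
    rays by the coordinates, and these generate the product sigma-algebra. *)
Lemma measurable_exp_closure_set A : measurable A -> exp_closure_set A.
Proof.
suff : @measurable _ T `<=` exp_closure_set by apply.
(* Stated for preimages by an arbitrary [h] to be used twice: with a coordinate, on the real line,
   and with the identity, on tuples. *)
have sigC (U : Type) (h : T -> U) :
    sigma_algebra setT [set B | exp_closure_set (h @^-1` B)].
  split => /=.
  - by rewrite preimage_set0; exact: exp_closure_set0.
  - by move=> B hB; rewrite setTD preimage_setC; exact: exp_closure_setC.
  - by move=> B hB; rewrite preimage_bigcup; exact: exp_closure_bigcup.
have key (i : 'I_n) : preimage_set_system setT (fun x : T => tnth x i)
    measurable `<=` exp_closure_set.
  move=> _ [B mB <-]; rewrite setTI.
  have {mB} : (@RGenOInfty.G R).-sigma.-measurable B.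
    by rewrite -RGenOInfty.measurableE.
  move: B.
  suff : <<s @RGenOInfty.G R >> `<=`
      [set B | exp_closure_set ((fun x : T => tnth x i) @^-1` B)] by apply.
  apply: smallest_sub; first exact: (sigC _ (fun x : T => tnth x i)).
  move=> _ [c ->] /=.
  rewrite (_ : _ @^-1` _ = [set x | c < tnth x i]); first exact: exp_closure_set_gt.
  by apply/seteqP; split => x /=; rewrite in_itv/= andbT.
apply: smallest_sub; first exact: (sigC _ id).
by elim/big_ind : _ => [//|B C hB hC D [/hB|/hC]//|i _]; exact: key.
Qed.

Import HBNNSimple.

Lemma nnsfun_exp_closure (f : {nnsfun T >-> R}) :
  exp_closure (f : T -> R).
Proof.
rewrite (_ : (f : T -> R) = fun x => \sum_(y <- finmap.enum_fset (fset_set (range f)))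
    y * \1_(f @^-1` [set y]) x).
  apply: exp_closure_sum => y; apply: exp_closureZ.
  by apply: measurable_exp_closure_set; exact: measurable_sfunP.
by apply/funext => x; rewrite fimfunE fsbig_finite.
Qed.

(** For nonnegative [f], approximation by simple functions from below is dominated by [f] itself,
    whose square is integrable. The general case splits [f] into positive and negative parts. *)
Lemma expsum_dense (mu : probability T R) :
  (forall a, rintegrable mu (fun x => expR (tdot a x))) ->
  forall f, measurable_fun setT f -> (sqint mu f < +oo)%E ->
  forall e : R, 0 < e -> exists s,
    (sqint mu (fun x => (f x - expsum s x)%R) <= e%:E)%E.
Proof.
move=> mu_exp.
have main f : measurable_fun setT f -> (forall x, 0 <= f x) ->
    rintegrable mu (fun x => f x ^+ 2) -> exp_approximable mu f.
  move=> mf f0 if2.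
  have mEf : measurable_fun setT (EFin \o f) by exact/measurable_EFinP.
  pose h := nnsfun_approx measurableT mEf.
  have hf k x : `|h k x| <= f x.
    rewrite ger0_norm// -lee_fin /h nnsfun_approxE.
    apply: (@le_approx _ _ _ setT (EFin \o f)) => //.
    by move=> y _; rewrite lee_fin.
  apply: (@exp_approximable_lim _ _ _ h f f) => //.
    by move=> k; apply: exp_closure_approximable => //; exact: nnsfun_exp_closure.
  move=> x; have : EFin \o h^~ x @ \oo --> (f x)%:E.
    by apply: cvg_nnsfun_approx => // y _; rewrite lee_fin.
  by move=> /fine_cvgP[].
move=> f mf sf.
have if2 : rintegrable mu (fun x => f x ^+ 2).
  by apply: rintegrable_ge0 => // [|x]; [exact: measurable_funX|exact: sqr_ge0].
have [_ //] : exp_approximable mu f.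
have -> : f = fun x => (-1) * Num.max (- f x) 0 + Num.max (f x) 0.
  apply/funext => x; rewrite !maxEle oppr_le0.
  by have [f0|f0|->] := ltgtP (f x) 0; ring.
have mN : measurable_fun setT (fun x => - f x) by exact: measurableT_comp.
have bnd (g : T -> R) : measurable_fun setT g -> (forall x, `|g x| = `|f x|) ->
    exp_approximable mu (fun x => Num.max (g x) 0).
  move=> mg gf; have mm : measurable_fun setT (fun x => Num.max (g x) 0).
    by apply: measurable_maxr.
  apply: main => //; first by move=> x; rewrite le_max lexx orbT.
  apply: (rintegrable_le _ _ if2); first exact: measurable_funX.
  move=> x; rewrite normrX -[leRHS]ger0_norm ?sqr_ge0// normrX.
  rewrite -gf lerXn2r ?nnegrE//.
  by rewrite maxEle; case: ifPn => //; rewrite normr0.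
by apply: exp_approximable_lin; apply: bnd => // x; rewrite normrN.
Qed.

End exp_closure_measurable_functions.

(** * Positive semidefinite kernels *)

Section law.
Context d d' (T : measurableType d) (T' : measurableType d') (R : realType).

(** [N] need only agree with the image measure on measurable sets, so it can be a Dirac mass, a
    normal law or a [distribution]. *)
Lemma integral_law (P : {measure set T -> \bar R}) (X : T -> T')
  (mX : measurable_fun setT X) (N : {measure set T' -> \bar R}) (f : T' -> \bar R) :
  (forall A, measurable A -> pushforward P X A = N A) ->
  measurable_fun setT f -> (forall y, (0 <= f y)%E) ->
  (\int[P]_x f (X x) = \int[N]_y f y)%E.
Proof.
move=> XN mf f0.
pose mixin := isMeasurableFun.Build _ _ _ _ _ mX.
pose X' : {mfun T >-> T'} := HB.pack X mixin.
transitivity (\int[pushforward P X']_y f y)%E.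
  by rewrite (ge0_integral_pushforward mX P measurableT mf).
by apply: eq_measure_integral => A mA _; exact: XN.
Qed.

End law.

Section psd_kernels.
Context (R : realType) (J : Type).
Implicit Types (K N : J -> J -> R) (s : seq (R * J)).

(** A list of weighted indices, repetitions allowed, encodes the coefficients of an exponential
    sum. *)
Definition kernel_form K s : R :=
  \sum_(p <- s) \sum_(q <- s) p.1 * q.1 * K p.2 q.2.

Definition psd_kernel K := forall s, 0 <= kernel_form K s.

Lemma eq_kernel_form K N s : (forall p q, K p q = N p q) ->
  kernel_form K s = kernel_form N s.
Proof. by move=> KN; do 2 (apply: eq_bigr => ? _); rewrite KN. Qed.

(** Absorbs into the coefficients the Gaussian factors [exp (variance / 2)] and, later, the block
    signs. *)
Lemma kernel_form_rescale K (h : J -> R) s :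
  kernel_form (fun p q => h p * h q * K p q) s =
  kernel_form K [seq (p.1 * h p.2, p.2) | p <- s].
Proof.
rewrite /kernel_form big_map; apply: eq_bigr => p _.
by rewrite big_map; apply: eq_bigr => q _ /=; ring.
Qed.

Lemma kernel_formD K N s :
  kernel_form (fun p q => K p q + N p q) s = kernel_form K s + kernel_form N s.
Proof.
rewrite /kernel_form -big_split; apply: eq_bigr => p _.
by rewrite -big_split; apply: eq_bigr => q _; rewrite mulrDr.
Qed.

Lemma kernel_formZ c K s :
  kernel_form (fun p q => c * K p q) s = c * kernel_form K s.
Proof.
rewrite /kernel_form mulr_sumr; apply: eq_bigr => p _.
by rewrite mulr_sumr; apply: eq_bigr => q _; ring.
Qed.

Lemma psd_kernelD K N : psd_kernel K -> psd_kernel N ->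
  psd_kernel (fun p q => K p q + N p q).
Proof. by move=> hK hN s; rewrite kernel_formD addr_ge0. Qed.

Lemma psd_kernelZ c K : 0 <= c -> psd_kernel K ->
  psd_kernel (fun p q => c * K p q).
Proof. by move=> c0 hK s; rewrite kernel_formZ mulr_ge0. Qed.

Lemma psd_kernel_rescale K (h : J -> R) : psd_kernel K ->
  psd_kernel (fun p q => h p * h q * K p q).
Proof. by move=> hK s; rewrite kernel_form_rescale. Qed.

Lemma psd_kernel1 : psd_kernel (fun _ _ => 1).
Proof.
move=> s; have -> : kernel_form (fun _ _ => 1) s = (\sum_(p <- s) p.1) ^+ 2.
  rewrite expr2 mulr_suml; apply: eq_bigr => p _.
  by rewrite mulr_sumr; apply: eq_bigr => q _; rewrite mulr1.
exact: sqr_ge0.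
Qed.

Lemma psd_kernel_series (K : nat -> J -> J -> R) N :
  (forall k, psd_kernel (K k)) ->
  (forall p q, series (fun k => K k p q) k @[k --> \oo] --> N p q) ->
  psd_kernel N.
Proof.
move=> hK KN s.
have c : kernel_form (fun p q => series (fun i => K i p q) k) s @[k --> \oo]
    --> kernel_form N s.
  apply: cvg_big => [|p _]; first by apply: add_continuous.
  apply: cvg_big => [|q _]; first by apply: add_continuous.
  by apply: cvgM; [exact: cvg_cst|exact: KN].
apply: (cvgr_to_ge c); near=> k.
have -> : kernel_form (fun p q => series (fun i => K i p q) k) s =
    \sum_(0 <= i < k) kernel_form (K i) s.
  rewrite /kernel_form [RHS]exchange_big/=; apply: eq_bigr => p _.
  rewrite [RHS]exchange_big/=; apply: eq_bigr => q _.
  by rewrite seriesEnat/= mulr_sumr.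
by apply: sumr_ge0 => i _; exact: hK.
Unshelve. all: by end_near.
Qed.

(* Schur product theorem when one factor is a Gram kernel in L^2. *)
Lemma psd_kernel_gramM d (T : measurableType d) (mu : {measure set T -> \bar R})
  (X : J -> T -> R) N :
  (forall p q, rintegrable mu (fun x => X p x * X q x)) ->
  psd_kernel N ->
  psd_kernel (fun p q => (\int[mu]_x (X p x * X q x)) * N p q).
Proof.
move=> iX hN s.
(* The form of the product is the average over [x] of the form of [N] with coefficients
   [p.1 * X p.2 x], which is nonnegative for each [x]. *)
have -> : kernel_form (fun p q => (\int[mu]_x (X p x * X q x)) * N p q) s =
    \int[mu]_x kernel_form N [seq (p.1 * X p.2 x, p.2) | p <- s].
  have i1 p q : rintegrable mu (fun x => (p.1 * q.1 * N p.2 q.2) *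
      (X p.2 x * X q.2 x)) by exact: rintegrableZ.
  have -> : (fun x => kernel_form N [seq (p.1 * X p.2 x, p.2) | p <- s]) =
      (fun x => \sum_(p <- s) \sum_(q <- s) (p.1 * q.1 * N p.2 q.2) *
        (X p.2 x * X q.2 x)).
    apply/funext => x; rewrite /kernel_form big_map; apply: eq_bigr => p _.
    by rewrite big_map; apply: eq_bigr => q _ /=; ring.
  rewrite Rintegral_sum => [|p]; last exact: rintegrable_sum.
  apply: eq_bigr => p _; rewrite Rintegral_sum//; apply: eq_bigr => q _.
  by rewrite RintegrableZ//; ring.
by apply: Rintegral_ge0 => x _; exact: hN.
Qed.

Lemma psd_kernel_gramXM d (T : measurableType d)
  (mu : {measure set T -> \bar R}) (X : J -> T -> R) N k :
  (forall p q, rintegrable mu (fun x => X p x * X q x)) ->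
  psd_kernel N ->
  psd_kernel (fun p q => (\int[mu]_x (X p x * X q x)) ^+ k * N p q).
Proof.
move=> iX hN; elim: k => [|k IH] s.
  by rewrite (@eq_kernel_form _ N)// => p q; rewrite expr0 mul1r.
rewrite (@eq_kernel_form _ (fun p q => (\int[mu]_x (X p x * X q x)) *
  ((\int[mu]_x (X p x * X q x)) ^+ k * N p q))); first exact: psd_kernel_gramM.
by move=> p q; rewrite exprS mulrA.
Qed.

End psd_kernels.

(** * Gaussian covariances as kernels indexed by vectors of the two blocks *)

Section gaussian_kernels.
Context (R : realType) (d1 d2 : nat).
Local Notation X := (xspace R d1 d2).
Local Notation J := ('rV[R]_d1 + 'rV[R]_d2)%type.
Implicit Types (v w : 'rV[R]_(d1 + d2)) (s : seq (R * J)).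

Definition linear_form v (x : X) : R := \sum_(k < d1 + d2) v 0 k * xcoord k x.

Lemma xcoord_lshift (i : 'I_d1) (x : X) : xcoord (lshift d2 i) x = tnth x.1 i.
Proof. by rewrite /xcoord (unsplitK (inl i)). Qed.

Lemma xcoord_rshift (j : 'I_d2) (x : X) : xcoord (rshift d1 j) x = tnth x.2 j.
Proof. by rewrite /xcoord (unsplitK (inr j)). Qed.

Lemma measurable_xcoord k : measurable_fun setT (@xcoord R d1 d2 k).
Proof.
rewrite /xcoord; case: fintype.split => i.
  exact: (measurableT_comp (measurable_tnth i) measurable_fst).
exact: (measurableT_comp (measurable_tnth i) measurable_snd).
Qed.

Lemma measurable_linear_form v : measurable_fun setT (linear_form v).
Proof.
apply: measurable_sum => k; apply: measurable_funM => //.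
exact: measurable_xcoord.
Qed.

Lemma linear_formD v w x :
  linear_form (v + w) x = linear_form v x + linear_form w x.
Proof. by rewrite -big_split; apply: eq_bigr => k _; rewrite mxE mulrDl. Qed.

Lemma linear_form_delta k x : linear_form (delta_mx 0 k) x = xcoord k x.
Proof.
rewrite /linear_form (bigD1 k)//= mxE !eqxx mul1r big1 ?addr0// => j jk.
by rewrite mxE (negbTE jk) andbF mul0r.
Qed.

Definition block_vector p : 'rV[R]_(d1 + d2) :=
  match p with inl a => row_mx a 0 | inr b => row_mx 0 b end.

Lemma linear_form_inl (a : 'rV[R]_d1) x :
  linear_form (block_vector (inl a)) x = tdot (a 0) x.1.
Proof.
rewrite /linear_form big_split_ord/= [X in _ + X]big1 ?addr0 => [|i _].
  by apply: eq_bigr => i _; rewrite row_mxEl xcoord_lshift.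
by rewrite row_mxEr mxE mul0r.
Qed.

Lemma linear_form_inr (b : 'rV[R]_d2) x :
  linear_form (block_vector (inr b)) x = tdot (b 0) x.2.
Proof.
rewrite /linear_form big_split_ord/= [X in X + _]big1 ?add0r => [|i _].
  by apply: eq_bigr => i _; rewrite row_mxEr xcoord_rshift.
by rewrite row_mxEl mxE mul0r.
Qed.

Definition block_dot p q : R := (block_vector p *m (block_vector q)^T) 0 0.

Definition same_block (p q : J) : bool :=
  match p, q with inl _, inl _ | inr _, inr _ => true | _, _ => false end.

(** Rescaling a kernel by these signs negates its off-diagonal blocks and preserves positivity. *)
Definition block_sign (p : J) : R := if p is inl _ then 1 else -1.

Lemma block_signM p q :
  block_sign p * block_sign q = if same_block p q then 1 else -1.
Proof. by case: p; case: q => /=; rewrite ?mul1r ?mulr1// mulrNN mulr1. Qed.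

Lemma block_dot_diff p q : ~~ same_block p q -> block_dot p q = 0.
Proof.
case: p; case: q => // a b _; rewrite /block_dot/= tr_row_mx mul_row_col.
  by rewrite trmx0 mulmx0 mul0mx addr0 mxE.
by rewrite trmx0 mulmx0 mul0mx addr0 mxE.
Qed.

Section one_law.
Context (P : probability X R).
Hypothesis gP : centered_gaussian P.

(** Both alternatives of [centered_gaussian] give a Laplace transform of the same form, with [s = 0]
    for the Dirac mass; [s ^+ 2] is then identified with the second moment. *)
Lemma gaussian_second_moment v :
  rintegrable P (fun x => linear_form v x ^+ 2) /\
  (\int[P]_x (expR (linear_form v x))%:E)%E =
  (expR (\int[P]_x (linear_form v x ^+ 2) / 2))%:E.
Proof.
have [s mgf] : exists s : R, forall t : R,
    (\int[P]_x (expR (t * linear_form v x))%:E)%E =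
    (expR (t ^+ 2 * s ^+ 2 / 2))%:E.
  have mt (t : R) : measurable_fun setT (fun y : R => (expR (t * y))%:E).
    by apply/measurable_EFinP; apply: measurableT_comp => //; exact: measurable_funM.
  have t0 (t y : R) : (0 <= (expR (t * y))%:E)%E by rewrite lee_fin expR_ge0.
  have [h|[s [s0 h]]] := gP (fun k => v 0 k).
    exists 0 => t.
    rewrite (integral_law (measurable_linear_form v)
      (f := fun y => (expR (t * y))%:E) h)//.
    rewrite integral_dirac//= diracT mul1e mulr0.
    by rewrite expr0n/= mulr0 mul0r.
  exists s => t.
  have := @integral_law _ _ X (measurableTypeR R) R P (linear_form v)
    (measurable_linear_form v) (normal_prob 0 s)
    (fun y => (expR (t * y))%:E) h (mt t) (t0 t).
  by rewrite normal_mgf.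
have [i2 e2] := second_moment_of_mgf (measurable_linear_form v) mgf.
split => //; rewrite e2; have := mgf 1.
by under eq_integral do rewrite mul1r; rewrite expr1n mul1r.
Qed.

Lemma rintegrable_linear_formM v w :
  rintegrable P (fun x => linear_form v x * linear_form w x).
Proof.
apply: (@rintegrable_le _ _ _ _ _
  (fun x => linear_form v x ^+ 2 + linear_form w x ^+ 2)).
- by apply: measurable_funM; exact: measurable_linear_form.
- move=> x; set a := linear_form v x; set b := linear_form w x.
  have := sqr_ge0 (a + b); have := sqr_ge0 (a - b).
  have := sqr_ge0 a; have := sqr_ge0 b.
  by rewrite ler_norml => *; apply/andP; split; nra.
- by apply: rintegrableD; exact: (gaussian_second_moment _).1.
Qed.

Lemma Rintegral_linear_formM v w :
  \int[P]_x (linear_form v x * linear_form w x) =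
  (v *m second_moment P *m w^T) 0 0.
Proof.
have ixx k l : rintegrable P (fun x => xcoord k x * xcoord l x).
  have := rintegrable_linear_formM (delta_mx 0 k) (delta_mx 0 l).
  by rewrite (_ : (fun _ => _) = fun x => xcoord k x * xcoord l x)//;
    apply/funext => x; rewrite !linear_form_delta.
have -> : (fun x => linear_form v x * linear_form w x) =
    (fun x => \sum_l \sum_k (v 0 k * w 0 l) * (xcoord k x * xcoord l x)).
  apply/funext => x; rewrite exchange_big mulr_suml; apply: eq_bigr => k _.
  by rewrite mulr_sumr; apply: eq_bigr => l _; ring.
rewrite Rintegral_sum => [|l]; last first.
  by apply: rintegrable_sum => k; exact: rintegrableZ.
rewrite !mxE; apply: eq_bigr => l _.
rewrite Rintegral_sum => [|k]; last exact: rintegrableZ.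
rewrite !mxE mulr_suml; apply: eq_bigr => k _.
by rewrite RintegrableZ// mxE mulrAC.
Qed.

Lemma Rintegral_linear_form_sqr v :
  \int[P]_x (linear_form v x ^+ 2) = (v *m second_moment P *m v^T) 0 0.
Proof. by rewrite -Rintegral_linear_formM. Qed.

Lemma trmx_second_moment : (second_moment P)^T = second_moment P.
Proof.
apply/matrixP => k l; rewrite !mxE; congr fine.
by apply: eq_integral => x _; rewrite mulrC.
Qed.

Lemma second_moment_psd v : 0 <= (v *m second_moment P *m v^T) 0 0.
Proof.
rewrite -Rintegral_linear_form_sqr; apply: Rintegral_ge0 => x _.
exact: sqr_ge0.
Qed.

Lemma rintegrable_expR_linear_form v :
  rintegrable P (fun x => expR (linear_form v x)).
Proof.
apply: rintegrable_ge0.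
- by apply: measurableT_comp => //; exact: measurable_linear_form.
- by move=> x; exact: expR_ge0.
- by rewrite (gaussian_second_moment v).2 ltry.
Qed.

Lemma Rintegral_expR_linear_form v :
  \int[P]_x expR (linear_form v x) =
  expR ((v *m second_moment P *m v^T) 0 0 / 2).
Proof.
by rewrite /Rintegral (gaussian_second_moment v).2 Rintegral_linear_form_sqr.
Qed.

Definition block_cov p q : R :=
  (block_vector p *m second_moment P *m (block_vector q)^T) 0 0.

Lemma block_covE p q : block_cov p q =
  \int[P]_x (linear_form (block_vector p) x * linear_form (block_vector q) x).
Proof. by rewrite Rintegral_linear_formM. Qed.

Definition block_expsum s (x : X) : R :=
  \sum_(p <- s) p.1 * expR (linear_form (block_vector p.2) x).

(** The variance of [(u + v) . x] is the sum of two diagonal terms and twice the covariance; after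
    halving, the diagonal terms factor out into the coefficients and only [exp] of the covariance
    remains as kernel. *)
Lemma rintegrable_block_expsum_sqr s :
  rintegrable P (fun x => block_expsum s x ^+ 2) /\
  \int[P]_x (block_expsum s x ^+ 2) =
  kernel_form (fun p q => expR (block_cov p q))
    [seq (p.1 * expR (block_cov p.2 p.2 / 2), p.2) | p <- s].
Proof.
have i1 (p q : J) (c : R) : rintegrable P (fun x => c *
    expR (linear_form (block_vector p + block_vector q) x)).
  by apply: rintegrableZ; exact: rintegrable_expR_linear_form.
have E : (fun x => block_expsum s x ^+ 2) = (fun x =>
    \sum_(p <- s) \sum_(q <- s) (p.1 * q.1) *
      expR (linear_form (block_vector p.2 + block_vector q.2) x)).
  apply/funext => x; rewrite expr2 mulr_suml; apply: eq_bigr => p _.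
  rewrite mulr_sumr; apply: eq_bigr => q _.
  by rewrite linear_formD expRD; ring.
rewrite E; split.
  by apply: rintegrable_sum => p; apply: rintegrable_sum => q.
rewrite Rintegral_sum => [|p]; last exact: rintegrable_sum.
rewrite -(kernel_form_rescale _ (fun p => expR (block_cov p p / 2))); apply: eq_bigr => p _.
rewrite Rintegral_sum => [|q]; last exact: i1.
apply: eq_bigr => q _.
rewrite RintegrableZ; last exact: rintegrable_expR_linear_form.
rewrite Rintegral_expR_linear_form; congr (_ * _).
rewrite -!expRD; congr expR.
rewrite -Rintegral_linear_form_sqr.
have -> : (fun x => linear_form (block_vector p.2 + block_vector q.2) x ^+ 2) =
  (fun x => linear_form (block_vector p.2) x * linear_form (block_vector p.2) x +
    (linear_form (block_vector q.2) x * linear_form (block_vector q.2) x +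
    2 * (linear_form (block_vector p.2) x * linear_form (block_vector q.2) x))).
  by apply/funext => x; rewrite linear_formD; ring.
have ip := rintegrable_linear_formM.
rewrite RintegrableD//; last by apply: rintegrableD => //; exact: rintegrableZ.
rewrite RintegrableD//; last exact: rintegrableZ.
rewrite RintegrableZ//.
by rewrite -!block_covE; field.
Qed.

Hypothesis P1 : forall i j : 'I_d1,
  (\int[P]_x (tnth x.1 i * tnth x.1 j)%:E)%E = ((i == j)%:R)%:E.
Hypothesis P2 : forall i j : 'I_d2,
  (\int[P]_x (tnth x.2 i * tnth x.2 j)%:E)%E = ((i == j)%:R)%:E.

Lemma second_moment_diag k : second_moment P k k = 1.
Proof.
rewrite mxE -[k]splitK; case: fintype.split => i /=.
  under eq_integral do rewrite xcoord_lshift.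
  by rewrite P1 eqxx.
under eq_integral do rewrite xcoord_rshift.
by rewrite P2 eqxx.
Qed.

Lemma block_cov_same p q : same_block p q -> block_cov p q = block_dot p q.
Proof.
have E1 : ulsubmx (second_moment P) = 1%:M.
  apply/matrixP => i j; rewrite !mxE.
  under eq_integral do rewrite !xcoord_lshift.
  by rewrite P1.
have E2 : drsubmx (second_moment P) = 1%:M.
  apply/matrixP => i j; rewrite !mxE.
  under eq_integral do rewrite !xcoord_rshift.
  by rewrite P2.
rewrite /block_cov /block_dot -[second_moment P]submxK E1 E2.
case: p; case: q => // a b _ /=; rewrite mul_row_block !tr_row_mx !mul_row_col.
  by rewrite !mul0mx !trmx0 !mulmx0 !addr0 mulmx1.
by rewrite !mul0mx !trmx0 !mulmx0 !add0r mulmx1.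
Qed.

End one_law.

End gaussian_kernels.

Lemma kernel_form_bilinear (R : realType) (J : Type) (m : nat)
  (w : J -> 'rV[R]_m) (B : 'M[R]_m) (s : seq (R * J)) :
  kernel_form (fun p q => (w p *m B *m (w q)^T) 0 0) s =
  ((\sum_(p <- s) p.1 *: w p.2) *m B *m (\sum_(p <- s) p.1 *: w p.2)^T) 0 0.
Proof.
rewrite mulmx_suml mulmx_suml summxE; apply: eq_bigr => p _.
rewrite linear_sum/= mulmx_sumr summxE; apply: eq_bigr => q _.
rewrite [(q.1 *: _)^T]linearZ/= -!scalemxAl -scalemxAr.
have mE (k l : R) (M : 'M[R]_1) : (k *: (l *: M)) 0 0 = k * l * M 0 0.
  by rewrite !mxE mulrA.
by rewrite mE.
Qed.

(** * Comparison of the two laws on exponential sums *)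

Section comparison.
Context (R : realType) (d1 d2 : nat) (P Q : probability (xspace R d1 d2) R).
Local Notation l := (lambda_min (second_moment P)).
Hypotheses (gP : centered_gaussian P) (gQ : centered_gaussian Q).
Hypothesis P1 : forall i j : 'I_d1,
  (\int[P]_x (tnth x.1 i * tnth x.1 j)%:E)%E = ((i == j)%:R)%:E.
Hypothesis P2 : forall i j : 'I_d2,
  (\int[P]_x (tnth x.2 i * tnth x.2 j)%:E)%E = ((i == j)%:R)%:E.
Hypothesis Q1 : forall i j : 'I_d1,
  (\int[Q]_x (tnth x.1 i * tnth x.1 j)%:E)%E = ((i == j)%:R)%:E.
Hypothesis Q2 : forall i j : 'I_d2,
  (\int[Q]_x (tnth x.2 i * tnth x.2 j)%:E)%E = ((i == j)%:R)%:E.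

Lemma lambda_min_second_moment_ge0 : 0 <= l.
Proof.
by have [] := lambda_min_rayleigh (trmx_second_moment P) (second_moment_psd gP).
Qed.

(** A coordinate vector has Rayleigh quotient 1, because the diagonal of the second moment matrix is
    1. Dimension 0 is excluded by [0 < l]. *)
Lemma lambda_min_second_moment_le1 : 0 < l -> l <= 1.
Proof.
have [_ ray] := lambda_min_rayleigh (trmx_second_moment P) (second_moment_psd gP).
move=> l0; have [n0|n0] := posnP (d1 + d2).
  move: (second_moment P) l0; rewrite n0 => S.
  by rewrite lambda_min_mx0 ltxx.
pose k : 'I_(d1 + d2) := Ordinal n0.
have := ray (delta_mx 0 k).
rewrite trmx_delta mul_delta_mx -rowE.
have -> : (row k (second_moment P) *m delta_mx k (0 : 'I_1)) 0 0 = 1.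
  by rewrite -colE !mxE -[RHS](second_moment_diag P1 P2 k) mxE.
by rewrite mxE !eqxx mulr1.
Qed.

(** The kernel form is the quadratic form of [second_moment P - l%:M] at the weighted sum of the
    block vectors, so this is the Rayleigh bound. *)
Lemma psd_block_cov_sub :
  psd_kernel (fun p q => block_cov P p q - l * block_dot p q).
Proof.
have [_ ray] := lambda_min_rayleigh (trmx_second_moment P) (second_moment_psd gP).
move=> s; rewrite (@eq_kernel_form _ _ _ (fun p q =>
  (block_vector p *m (second_moment P - l%:M) *m (block_vector q)^T) 0 0)).
  rewrite kernel_form_bilinear; set W := \sum_(p <- s) _.
  rewrite mulmxBr mul_mx_scalar mulmxBl -scalemxAl [X in _ <= X]mxE.
  by rewrite [X in _ + X]mxE [X in _ - X]mxE subr_ge0; exact: ray.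
move=> p q; rewrite mulmxBr mul_mx_scalar mulmxBl -scalemxAl [RHS]mxE.
by rewrite [X in _ = _ + X]mxE [X in _ = _ - X]mxE.
Qed.

(* Termwise in the Taylor series of the exponential.  In degree k + 1 the
   kernel is [2 / l] times [block_cov P ^ k * (block_cov P - l * block_dot)],
   because [block_cov P] and [block_dot] agree on equal blocks and [block_dot]
   vanishes on different ones, plus [2 * block_dot ^ k.+1 - block_cov Q ^ k.+1],
   which is [block_cov Q ^ k.+1] with its off-diagonal blocks negated. *)
Lemma psd_expR_block_cov_sub : 0 < l -> psd_kernel (fun p q =>
  2 / l * expR (block_cov P p q) - expR (block_cov Q p q)).
Proof.
move=> l0; have l1 := lambda_min_second_moment_le1 l0.
have l2 : 1 <= 2 / l by rewrite ler_pdivlMr// mul1r; lra.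
pose K (k : nat) p q := 2 / l * exp_coeff (block_cov P p q) k -
  exp_coeff (block_cov Q p q) k.
apply: (@psd_kernel_series _ _ K) => [[|k]|p q]; last first.
- have -> : series (fun k => K k p q) = (fun k =>
      2 / l * series (exp_coeff (block_cov P p q)) k -
      series (exp_coeff (block_cov Q p q)) k).
    apply/funext => k; rewrite !seriesEnat/= /K mulr_sumr -sumrB.
    by apply: eq_bigr.
  apply: cvgB; last exact: is_cvg_series_exp_coeff.
  by apply: cvgM; [exact: cvg_cst|exact: is_cvg_series_exp_coeff].
- have iP p q := rintegrable_linear_formM gP (block_vector p) (block_vector q).
  have iQ p q := rintegrable_linear_formM gQ (block_vector p) (block_vector q).
  have hP := psd_kernel_gramXM k iP psd_block_cov_sub.
  have hQ := psd_kernel_gramXM k.+1 iQ (@psd_kernel1 _ _).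
  have hQ' := psd_kernel_rescale (@block_sign R d1 d2) hQ.
  have c0 : 0 <= 2 / l by lra.
  have f0 : 0 <= (k.+1`!%:R)^-1 :> R by rewrite invr_ge0.
  have h := psd_kernelZ f0 (psd_kernelD (psd_kernelZ c0 hP) hQ').
  move=> s; have := h s; congr (0 <= _); apply: eq_kernel_form => p q.
  rewrite -!block_covE// /K /exp_coeff/= mulr1.
  have lN : l != 0 by rewrite gt_eqF.
  have kN : k.+1`!%:R != 0 :> R by rewrite pnatr_eq0 -lt0n fact_gt0.
  (* On equal blocks both covariances equal the dot product [D], and
     [(2 / l) * D ^ k * (D - l D) + D ^ k.+1] is [(2 / l - 1) * D ^ k.+1]; on different blocks the
     dot product is 0 and the sign is -1. *)
  rewrite block_signM; case: ifPn => pq.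
    rewrite (block_cov_same P1 P2 pq) (block_cov_same Q1 Q2 pq) exprS.
    by field; apply/andP.
  by rewrite block_dot_diff// !exprS; field; apply/andP.
(* Degree 0 is the constant kernel [2 / l - 1], nonnegative because [l <= 1]. *)
- have c0 : 0 <= 2 / l - 1 by lra.
  move=> s; have := psd_kernelZ c0 (@psd_kernel1 _ _) s; congr (0 <= _).
  apply: eq_kernel_form => p q.
  by rewrite /K /exp_coeff/= !expr0 fact0 divr1 !mulr1.
Qed.

Lemma sqint_block_expsum_le s : 0 < l ->
  (sqint Q (block_expsum s) <= (2 / l)%:E * sqint P (block_expsum s))%E.
Proof.
move=> l0.
have [iP EP] := rintegrable_block_expsum_sqr gP s.
have [iQ EQ] := rintegrable_block_expsum_sqr gQ s.
rewrite /sqint !EFin_Rintegral// -EFinM lee_fin EP EQ.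
have same p : same_block p p by case: p.
(* Variances of one-block linear forms are fixed by the identity diagonal blocks, so both laws lead
   to the same coefficients. *)
have -> : [seq (p.1 * expR (block_cov Q p.2 p.2 / 2), p.2) | p <- s] =
    [seq (p.1 * expR (block_cov P p.2 p.2 / 2), p.2) | p <- s].
  apply: eq_map => p; congr (_ * expR (_ / 2), _).
  by rewrite (block_cov_same P1 P2)// (block_cov_same Q1 Q2).
rewrite -kernel_formZ -subr_ge0.
have := psd_expR_block_cov_sub l0 [seq (p.1 * expR (block_cov P p.2 p.2 / 2), p.2) | p <- s].
congr (0 <= _).
rewrite (@eq_kernel_form _ _ _ (fun p q =>
  2 / l * expR (block_cov P p q) + (-1) * expR (block_cov Q p q))).
  by rewrite kernel_formD (kernel_formZ (-1)) mulN1r.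
by move=> p q; rewrite mulN1r.
Qed.

End comparison.

(** * From exponentials to additive functions *)

Lemma sqint_law d d' (T : measurableType d) (T' : measurableType d')
  (R : realType) (P : {measure set T -> \bar R}) (X : T -> T')
  (mX : measurable_fun setT X) (N : {measure set T' -> \bar R}) (f : T' -> R) :
  (forall A, measurable A -> pushforward P X A = N A) ->
  measurable_fun setT f -> sqint P (fun x => f (X x)) = sqint N f.
Proof.
move=> XN mf; rewrite /sqint -(integral_law mX (f := fun y => (f y ^+ 2)%:E) XN)//.
  by apply/measurable_EFinP; exact: measurable_funX.
by move=> y; rewrite lee_fin sqr_ge0.
Qed.

(** Signed integrands are allowed, as needed for products of coordinates; hence the integrability
    assumptions. *)
Lemma eq_law_integral d d' (T : measurableType d) (T' : measurableType d')
  (R : realType) (P Q : probability T R) (X : T -> T')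
  (mX : measurable_fun setT X) (f : T' -> \bar R) :
  (forall A, measurable A -> P (X @^-1` A) = Q (X @^-1` A)) ->
  measurable_fun setT f ->
  P.-integrable setT (fun x => f (X x)) ->
  Q.-integrable setT (fun x => f (X x)) ->
  (\int[P]_x f (X x) = \int[Q]_x f (X x))%E.
Proof.
move=> PQ mf iP iQ.
pose mixin := isMeasurableFun.Build _ _ _ _ _ mX.
pose F : {RV P >-> T'} := HB.pack X mixin.
pose G : {RV Q >-> T'} := HB.pack X mixin.
transitivity (\int[distribution P F]_y f y)%E.
  by rewrite integral_distribution.
rewrite (eq_measure_integral (distribution Q G)); last by move=> A mA _; exact: PQ.
by rewrite integral_distribution.
Qed.

Lemma eq_law_sqint d d' (T : measurableType d) (T' : measurableType d')
  (R : realType) (P Q : probability T R) (X : T -> T')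
  (mX : measurable_fun setT X) (f : T' -> R) :
  (forall A, measurable A -> P (X @^-1` A) = Q (X @^-1` A)) ->
  measurable_fun setT f ->
  sqint P (fun x => f (X x)) = sqint Q (fun x => f (X x)).
Proof.
move=> PQ mf; pose mixin := isMeasurableFun.Build _ _ _ _ _ mX.
pose G : {RV Q >-> T'} := HB.pack X mixin.
rewrite (sqint_law mX (N := distribution Q G))//.
by rewrite (sqint_law mX (N := distribution Q G)).
Qed.

(** Density is applied to the law of [X] and pulled back, so that the approximating sums depend on
    [x] only through [X x]. *)
Lemma expsum_dense_pushforward d (T : measurableType d) (R : realType) (n : nat)
  (P : probability T R) (X : T -> n.-tuple R) (f : n.-tuple R -> R) :
  measurable_fun setT X -> measurable_fun setT f ->
  (forall a, rintegrable P (fun x => expR (tdot a (X x)))) ->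
  (sqint P (fun x => f (X x)) < +oo)%E ->
  forall e : R, 0 < e -> exists s,
    (sqint P (fun x => (f (X x) - expsum s (X x))%R) <= e%:E)%E.
Proof.
move=> mX mf iX sf e e0.
pose mixin := isMeasurableFun.Build _ _ _ _ _ mX.
pose X' : {RV P >-> n.-tuple R} := HB.pack X mixin.
have law A : measurable A -> pushforward P X A = distribution P X' A by [].
have ia a : rintegrable (distribution P X') (fun x => expR (tdot a x)).
  apply: rintegrable_ge0; first exact: measurable_expR_tdot.
    by move=> x; exact: expR_ge0.
  rewrite -(integral_law mX (f := fun y => (expR (tdot a y))%:E) law).
  - by rewrite EFin_Rintegral ?ltry//; exact: iX.
  - by apply/measurable_EFinP; exact: measurable_expR_tdot.
  - by move=> y; rewrite lee_fin expR_ge0.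
rewrite (sqint_law mX law mf) in sf.
have [s hs] := expsum_dense ia mf sf e0.
exists s; rewrite -(sqint_law mX law) in hs => //.
by apply: measurable_funB => //; exact: measurable_expsum.
Qed.

Section transfer.
Context (R : realType) (d1 d2 : nat) (P Q : probability (xspace R d1 d2) R).
Local Notation X := (xspace R d1 d2).
Local Notation l := (lambda_min (second_moment P)).
Hypotheses (gP : centered_gaussian P) (gQ : centered_gaussian Q).
Hypothesis marg1 : forall A : set (d1.-tuple R), measurable A ->
  P (fst @^-1` A) = Q (fst @^-1` A).
Hypothesis marg2 : forall B : set (d2.-tuple R), measurable B ->
  P (snd @^-1` B) = Q (snd @^-1` B).
Hypothesis P1 : forall i j : 'I_d1,
  (\int[P]_x (tnth x.1 i * tnth x.1 j)%:E)%E = ((i == j)%:R)%:E.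
Hypothesis P2 : forall i j : 'I_d2,
  (\int[P]_x (tnth x.2 i * tnth x.2 j)%:E)%E = ((i == j)%:R)%:E.

Let mfst : measurable_fun setT (fst : X -> d1.-tuple R).
Proof. exact: measurable_fst. Qed.

Let msnd : measurable_fun setT (snd : X -> d2.-tuple R).
Proof. exact: measurable_snd. Qed.

Lemma exp_tdot_fst (a : 'I_d1 -> R) :
  rintegrable P (fun x => expR (tdot a x.1)).
Proof.
have := rintegrable_expR_linear_form gP (block_vector (inl (\row_i a i))).
congr (rintegrable P); apply/funext => x; rewrite linear_form_inl.
by congr expR; apply: eq_bigr => i _; rewrite mxE.
Qed.

Lemma exp_tdot_snd (a : 'I_d2 -> R) :
  rintegrable P (fun x => expR (tdot a x.2)).
Proof.
have := rintegrable_expR_linear_form gP (block_vector (inr (\row_i a i))).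
congr (rintegrable P); apply/funext => x; rewrite linear_form_inr.
by congr expR; apply: eq_bigr => i _; rewrite mxE.
Qed.

Lemma second_moment_marginal1 (i j : 'I_d1) :
  (\int[Q]_x (tnth x.1 i * tnth x.1 j)%:E)%E = ((i == j)%:R)%:E.
Proof.
have iM (L : probability X R) : centered_gaussian L ->
    L.-integrable setT (fun x => (tnth x.1 i * tnth x.1 j)%:E).
  move=> gL; have := rintegrable_linear_formM gL
    (delta_mx 0 (lshift d2 i)) (delta_mx 0 (lshift d2 j)).
  apply: eq_integrable => // x _ /=.
  by rewrite !linear_form_delta !xcoord_lshift.
rewrite -P1; apply/esym.
apply: (eq_law_integral mfst marg1 (f := fun y => (tnth y i * tnth y j)%:E)).
- by apply/measurable_EFinP; apply: measurable_funM; exact: measurable_tnth.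
- exact: iM.
- exact: iM.
Qed.

Lemma second_moment_marginal2 (i j : 'I_d2) :
  (\int[Q]_x (tnth x.2 i * tnth x.2 j)%:E)%E = ((i == j)%:R)%:E.
Proof.
have iM (L : probability X R) : centered_gaussian L ->
    L.-integrable setT (fun x => (tnth x.2 i * tnth x.2 j)%:E).
  move=> gL; have := rintegrable_linear_formM gL
    (delta_mx 0 (rshift d1 i)) (delta_mx 0 (rshift d1 j)).
  apply: eq_integrable => // x _ /=.
  by rewrite !linear_form_delta !xcoord_rshift.
rewrite -P2; apply/esym.
apply: (eq_law_integral msnd marg2 (f := fun y => (tnth y i * tnth y j)%:E)).
- by apply/measurable_EFinP; apply: measurable_funM; exact: measurable_tnth.
- exact: iM.
- exact: iM.
Qed.

(** [h1] and [h2] are approximated separately under [P]. Each error depends on one block, so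
    equality of the marginals gives the same errors under [Q], and the inequality for exponential
    sums passes to the limit. *)
Lemma sqint_additive_le (h1 : d1.-tuple R -> R) (h2 : d2.-tuple R -> R) :
  measurable_fun setT h1 -> measurable_fun setT h2 ->
  (sqint P (fun x => h1 x.1) < +oo)%E -> (sqint P (fun x => h2 x.2) < +oo)%E ->
  0 < l ->
  (sqint Q (fun x => (h1 x.1 + h2 x.2)%R) <=
   (2 / l)%:E * sqint P (fun x => (h1 x.1 + h2 x.2)%R))%E.
Proof.
move=> mh1 mh2 s1 s2 l0; set c := 2 / l.
have c0 : 0 < c by rewrite divr_gt0.
pose F (x : X) : R := h1 x.1 + h2 x.2.
have m1 (f : d1.-tuple R -> R) : measurable_fun setT f ->
    measurable_fun setT (fun x : X => f x.1).
  by move=> mf; exact: (measurableT_comp mf mfst).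
have m2 (f : d2.-tuple R -> R) : measurable_fun setT f ->
    measurable_fun setT (fun x : X => f x.2).
  by move=> mf; exact: (measurableT_comp mf msnd).
have sq_add (a b : R) : (a + b) ^+ 2 <= 2 * a ^+ 2 + 2 * b ^+ 2.
  by have := sqr_ge0 (a - b); nra.
have mF : measurable_fun setT F by apply: measurable_funD; [exact: m1|exact: m2].
have FP : (sqint P F < +oo)%E.
  apply: (@le_lt_trans _ _ (2%:E * sqint P (fun x => h1 x.1) +
      2%:E * sqint P (fun x => h2 x.2))%E).
    by apply: sqint_le => //; first [exact: m1|exact: m2|by move=> x; exact: sq_add].
  by rewrite lte_add_pinfty// lte_mul_pinfty.
have [A A0 AE] : exists2 A : R, 0 <= A & sqint P F = A%:E.
  have := FP; have := sqint_ge0 P F.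
  by case: (sqint P F) => // A A0 _; exists A.
(* For [h <= 1], [(1 + h)^2 <= 1 + 3 h] yields [3 * c * A]. The error term [4 h^2 + 4 h <= 8 h]
   yields 8, and [16 * c] once multiplied by [c] and [1 + h <= 2]. *)
have key (h : R) : 0 < h -> h <= 1 ->
    (sqint Q F <= (c * A + h * (3 * c * A + 16 * c + 8))%:E)%E.
  move=> h0 h1'.
  (* The tolerance is [h ^+ 2] so that the Young weight [1 + h^-1] still leaves an error of order
     [h]. *)
  have e0 : 0 < h ^+ 2 by rewrite exprn_gt0.
  have [t1 ht1] := expsum_dense_pushforward mfst mh1 exp_tdot_fst s1 e0.
  have [t2 ht2] := expsum_dense_pushforward msnd mh2 exp_tdot_snd s2 e0.
  have me1 := measurable_expsum t1; have me2 := measurable_expsum t2.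
  pose s : seq (R * ('rV[R]_d1 + 'rV[R]_d2)) :=
    [seq (p.1, inl (\row_i p.2 i)) | p <- t1] ++
    [seq (p.1, inr (\row_i p.2 i)) | p <- t2].
  have sE (x : X) : block_expsum s x = expsum t1 x.1 + expsum t2 x.2.
    rewrite /block_expsum big_cat !big_map; congr (_ + _); apply: eq_bigr => p _.
      rewrite linear_form_inl; congr (_ * expR _).
      by apply: eq_bigr => i _; rewrite mxE.
    rewrite linear_form_inr; congr (_ * expR _).
    by apply: eq_bigr => i _; rewrite mxE.
  pose E := block_expsum s; pose D (x : X) := F x - E x.
  have mE : measurable_fun setT E.
    rewrite /E (funext sE); apply: measurable_funD; [exact: m1|exact: m2].
  have mD : measurable_fun setT D by exact: measurable_funB.
  have Dle (L : probability X R) :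
      (sqint L (fun x => (h1 x.1 - expsum t1 x.1)%R) <= (h ^+ 2)%:E)%E ->
      (sqint L (fun x => (h2 x.2 - expsum t2 x.2)%R) <= (h ^+ 2)%:E)%E ->
      (sqint L D <= (4 * h ^+ 2)%:E)%E.
    move=> l1 l2.
    apply: (@le_trans _ _ (2%:E * (h ^+ 2)%:E + 2%:E * (h ^+ 2)%:E)%E).
      apply: (le_trans (@sqint_le _ _ _ L (fun x => h1 x.1 - expsum t1 x.1)
        (fun x => h2 x.2 - expsum t2 x.2) D 2 2 _ _ _ _ _ _)) => //.
      - by apply: (m1 (fun y => h1 y - expsum t1 y)); exact: measurable_funB.
      - by apply: (m2 (fun y => h2 y - expsum t2 y)); exact: measurable_funB.
      - move=> x; rewrite /D /F /E sE.
        rewrite (_ : _ - _ = (h1 x.1 - expsum t1 x.1) + (h2 x.2 - expsum t2 x.2)).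
          exact: sq_add.
        by ring.
      - by apply: leeD; apply: lee_wpmul2l.
    rewrite -!EFinM -EFinD lee_fin le_eqVlt; apply/orP; left; apply/eqP.
    by ring.
  have DP := Dle P ht1 ht2.
  have DQ : (sqint Q D <= (4 * h ^+ 2)%:E)%E.
    apply: Dle.
      rewrite -(eq_law_sqint mfst marg1 (f := fun y => h1 y - expsum t1 y))//.
      exact: measurable_funB.
    rewrite -(eq_law_sqint msnd marg2 (f := fun y => h2 y - expsum t2 y))//.
    exact: measurable_funB.
  have young (a b : R) : (a + b) ^+ 2 <= (1 + h) * a ^+ 2 + (1 + h^-1) * b ^+ 2.
    rewrite -subr_ge0 (_ : _ - _ = (h * a - b) ^+ 2 / h); last first.
      by field; rewrite gt_eqF.
    by rewrite divr_ge0 ?sqr_ge0// ltW.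
  have hh0 : 0 <= 1 + h by lra.
  have hi0 : 0 <= 1 + h^-1 by rewrite addr_ge0// invr_ge0 ltW.
  have EP : (sqint P E <= ((1 + h) * A + (1 + h^-1) * (4 * h ^+ 2))%:E)%E.
    (* Young is used twice: here for [E = F - D] under [P], and below for [F = E + D] under [Q]. *)
    apply: (le_trans (@sqint_le _ _ _ P F D E (1 + h) (1 + h^-1) _ _ _ _ _ _)) => //.
      move=> x; rewrite (_ : E x = F x + - D x); last by rewrite /D; ring.
      by rewrite -(sqrrN (D x)); exact: young.
    rewrite AE [X in (_ <= X)%E]EFinD (EFinM _ A) (EFinM _ (4 * h ^+ 2)).
    by rewrite leeD2l// lee_wpmul2l.
  have EQ : (sqint Q E <=
      (c * ((1 + h) * A + (1 + h^-1) * (4 * h ^+ 2)))%:E)%E.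
    apply: (le_trans (sqint_block_expsum_le gP gQ P1 P2 second_moment_marginal1
      second_moment_marginal2 s l0)).
    rewrite (EFinM c); apply: lee_wpmul2l; last exact: EP.
    by rewrite lee_fin ltW.
  apply: (le_trans (@sqint_le _ _ _ Q E D F (1 + h) (1 + h^-1) _ _ _ _ _ _)) => //.
    by move=> x; rewrite (_ : F x = E x + D x); [exact: young|rewrite /D; ring].
  apply: (@le_trans _ _ ((1 + h)%:E *
      (c * ((1 + h) * A + (1 + h^-1) * (4 * h ^+ 2)))%:E +
      (1 + h^-1)%:E * (4 * h ^+ 2)%:E)%E).
    by apply: leeD; apply: lee_wpmul2l.
  rewrite -!EFinM -EFinD lee_fin.
  have -> : (1 + h^-1) * (4 * h ^+ 2) = 4 * h ^+ 2 + 4 * h.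
    by field; rewrite gt_eqF.
  have hh : h ^+ 2 <= h by rewrite expr2 ler_piMl// ltW.
  have b1 : (1 + h) * (c * ((1 + h) * A)) <= c * A + h * (3 * c * A).
    have cA : 0 <= c * A by rewrite mulr_ge0// ltW.
    rewrite -subr_ge0 (_ : _ - _ = (c * A) * (h - h ^+ 2)); last by ring.
    by rewrite mulr_ge0// subr_ge0.
  have b2 : (1 + h) * (c * (4 * h ^+ 2 + 4 * h)) <= h * (16 * c).
    rewrite (_ : h * (16 * c) = 2 * (c * (8 * h))); last by ring.
    apply: ler_pM => //.
    - by apply: mulr_ge0; [exact: ltW|lra].
    - by lra.
    - by apply: ler_wpM2l; [exact: ltW|lra].
  rewrite (mulrDr c) (mulrDr (1 + h)) (mulrDr h) (mulrDr h).
  by lra.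
rewrite -/F AE -EFinM; apply/lee_addgt0Pr => e e0.
pose K := 3 * c * A + 16 * c + 8.
have K0 : 0 < K.
  by have := mulr_ge0 (ltW c0) A0; rewrite /K; lra.
pose h := Num.min 1 (e / K).
have h0 : 0 < h by rewrite lt_min ltr01 divr_gt0.
have h1' : h <= 1 by rewrite ge_min lexx.
apply: (le_trans (key h h0 h1')); rewrite -EFinD lee_fin lerD2l -/K.
by rewrite -ler_pdivlMr// ge_min lexx orbT.
Qed.

End transfer.

Theorem mainTheorem6 (R : realType) (d1 d2 : nat)
  (P Q : probability (xspace R d1 d2) R) :
  centered_gaussian P -> centered_gaussian Q ->
  (forall A : set (d1.-tuple R), measurable A ->
     P (fst @^-1` A) = Q (fst @^-1` A)) ->
  (forall B : set (d2.-tuple R), measurable B ->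
     P (snd @^-1` B) = Q (snd @^-1` B)) ->
  (forall i j : 'I_d1,
     (\int[P]_x (tnth x.1 i * tnth x.1 j)%:E)%E = ((i == j)%:R)%:E) ->
  (forall i j : 'I_d2,
     (\int[P]_x (tnth x.2 i * tnth x.2 j)%:E)%E = ((i == j)%:R)%:E) ->
  (tau P Q (additive_class P) <= bound (lambda_min (second_moment P)))%E.
Proof.
move=> gP gQ marg1 marg2 P1 P2; rewrite /bound.
set l := lambda_min _; have [_|lN] := eqVneq l 0; first exact: leey.
have l0 : 0 < l by rewrite lt_neqAle eq_sym lN; exact: lambda_min_second_moment_ge0.
apply: ge_ereal_sup => _ [f [g [[f1 [f2 [mf1 mf2 if1 if2 ->]]]
  [[g1 [g2 [mg1 mg2 ig1 ig2 ->]]] ->]]]].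
have sq_sub (a b : R) : (a - b) ^+ 2 <= 2 * a ^+ 2 + 2 * b ^+ 2.
  by have := sqr_ge0 (a + b); nra.
(* The difference of two members of the class is additive, with square integrable components
   [f1 - g1] and [f2 - g2]. *)
have ih1 : (sqint P (fun x => (f1 x.1 - g1 x.1)%R) < +oo)%E.
  apply: (@le_lt_trans _ _ (2%:E * sqint P (fun x => f1 x.1) +
      2%:E * sqint P (fun x => g1 x.1))%E); last first.
    by rewrite lte_add_pinfty// lte_mul_pinfty.
  have m (h : d1.-tuple R -> R) : measurable_fun setT h ->
      measurable_fun setT (fun x : xspace R d1 d2 => h x.1).
    by move=> mh; exact: (measurableT_comp mh measurable_fst).
  have mB := m (fun y => f1 y - g1 y) (measurable_funB mf1 mg1).
  by apply: sqint_le => //; first [exact: m|by move=> x; exact: sq_sub].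
have ih2 : (sqint P (fun x => (f2 x.2 - g2 x.2)%R) < +oo)%E.
  apply: (@le_lt_trans _ _ (2%:E * sqint P (fun x => f2 x.2) +
      2%:E * sqint P (fun x => g2 x.2))%E); last first.
    by rewrite lte_add_pinfty// lte_mul_pinfty.
  have m (h : d2.-tuple R -> R) : measurable_fun setT h ->
      measurable_fun setT (fun x : xspace R d1 d2 => h x.2).
    by move=> mh; exact: (measurableT_comp mh measurable_snd).
  have mB := m (fun y => f2 y - g2 y) (measurable_funB mf2 mg2).
  by apply: sqint_le => //; first [exact: m|by move=> x; exact: sq_sub].
have := sqint_additive_le gP gQ marg1 marg2 P1 P2
  (measurable_funB mf1 mg1) (measurable_funB mf2 mg2) ih1 ih2 l0.
rewrite /sqint -/l.
have E (x : xspace R d1 d2) : f1 x.1 - g1 x.1 + (f2 x.2 - g2 x.2) =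
    f1 x.1 + f2 x.2 - (g1 x.1 + g2 x.2) by ring.
under eq_integral do rewrite /= E.
under [X in (_ <= _ * X)%E -> _]eq_integral do rewrite /= E.
set num := (\int[Q]_x _)%E; set den := (\int[P]_x _)%E => le_nd.
have num0 : (0 <= num)%E by apply: integral_ge0 => x _; rewrite lee_fin sqr_ge0.
have den0 : (0 <= den)%E by apply: integral_ge0 => x _; rewrite lee_fin sqr_ge0.
(* A zero denominator forces a zero numerator by the inequality, so the ratio is [0 / 0 = 0]. *)
rewrite /eratio; case: ifPn => [/eqP dE|dN].
  rewrite dE mule0 in le_nd.
  have -> : num = 0%E by apply/eqP; rewrite eq_le le_nd.
  by rewrite eqxx lee_fin divr_ge0// ltW.
(* For an infinite denominator [fine] returns 0, whose inverse is 0, so the ratio is 0. *)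
case: den le_nd den0 dN => [A| |]//= le_nd A0 AN; last first.
  by rewrite invr0 mule0 lee_fin divr_ge0// ltW.
have Ap : 0 < A by rewrite lt_neqAle eq_sym -eqe AN -lee_fin.
apply: (@le_trans _ _ ((2 / l)%:E * A%:E * A^-1%:E)%E).
  by apply: lee_wpmul2r => //; rewrite lee_fin invr_ge0 ltW.
by rewrite -!EFinM lee_fin mulfK// gt_eqF.
Qed.
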